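(* Let $n\ge 3$ be an integer. There exists a box space of the free group $F_n$ such that, for every positive integer $m$ with $m-1$ coprime to $n-1$, no box space of the free group $F_m$ is coarsely equivalent to it.
   Context: $F_n$ is the free group of rank $n$. Filtration: for a residually finite, finitely generated group $G$, a filtration of $G$ is a sequence $(N_i)_{i\in\mathbb{N}}$ of nested ($N_{i+1}\subseteq N_i$), normal, finite index subgroups of $G$ with $\bigcap_i N_i=\{e\}$. Box space: fix a finite generating set $S$ of $G$. The box space $\Box_{(N_i)}G$ of $G$ with respect to a filtration $(N_i)$ is the disjoint union $\bigsqcup_i G/N_i$, where each component $G/N_i$ carries the Cayley graph metric with respect to the image of $S$, and the distance between any two distinct components (i.e. between points of them) is the sum of their diameters. Changing the finite generating set gives a coarsely equivalent space. Coarse equivalence: a map $\varphi:X\to Y$ between metric spaces is a coarse embedding if there are proper functions $\rho_\pm:\mathbb{R}_+\to\mathbb{R}_+$ with $\rho_-(d_X(a,b))\le d_Y(\varphi(a),\varphi(b))\le\rho_+(d_X(a,b))$ for all $a,b\in X$. It is a coarse equivalence if moreover there is $C>0$ such that every $y\in Y$ is at distance at most $C$ from $\varphi(X)$. $X$ and $Y$ are coarsely equivalent if a coarse equivalence $X\to Y$ exists. *)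

(* Defs.v *)
From HB Require Import structures.
From mathcomp Require Import all_boot all_order all_algebra.
From mathcomp Require Import all_classical all_reals all_analysis.

Set Implicit Arguments.
Unset Strict Implicit.
Unset Printing Implicit Defensive.

Import Order.TTheory GRing.Theory Num.Theory.
Import numFieldNormedType.Exports.

Local Open Scope classical_set_scope.
Local Open Scope ring_scope.
Local Open Scope quotient_scope.

Section FreeGroup.
Variable A : choiceType.

(* [(a, false)] stands for the generator [a] and [(a, true)] for its inverse. *)
Definition letter : Type := (A * bool)%type.

HB.instance Definition _ := Choice.on letter.

Definition letter_inv (l : letter) : letter := (l.1, ~~ l.2).

Definition reduced (w : seq letter) : bool :=
  sorted (fun l l' => l' != letter_inv l) w.

Record free_group := FreeGroup {
  fg_word :> seq letter;
  fg_reduced : reduced fg_word }.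

HB.instance Definition _ := [isSub for fg_word].
HB.instance Definition _ := [Choice of free_group by <:].

Definition push (l : letter) (w : seq letter) : seq letter :=
  if w is l' :: w' then if l' == letter_inv l then w' else l :: w
  else [:: l].

Definition word_mul (u v : seq letter) : seq letter := foldr push v u.

Definition word_inv (u : seq letter) : seq letter := rev (map letter_inv u).

Lemma letter_invK : involutive letter_inv.
Proof. by case=> a b; rewrite /letter_inv /= negbK. Qed.

Lemma reduced_push l w : reduced w -> reduced (push l w).
Proof.
case: w => [|l' w] //= red; case: ifP => [_|/negbT neq] /=.
  exact: path_sorted red.
by rewrite neq red.
Qed.

Lemma reduced_mul u v : reduced v -> reduced (word_mul u v).
Proof. by move=> red; elim: u => //= l u; apply: reduced_push. Qed.

Lemma reduced_inv u : reduced u -> reduced (word_inv u).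
Proof.
rewrite /reduced /word_inv rev_sorted sorted_map.
apply: sub_sorted => l l' /= neq; apply: contra neq => /eqP.
by rewrite letter_invK => ->.
Qed.

Lemma pushK l w : reduced w -> push l (push (letter_inv l) w) = w.
Proof.
case: w => [|l' w] /=; first by rewrite eqxx.
rewrite letter_invK; case: (l' =P l) => [->|_] /=; last by rewrite eqxx.
by case: w => [|l2 w] //= /andP[/negbTE ->].
Qed.

Lemma word_mul_push l u w :
  reduced u -> reduced w -> word_mul (push l u) w = push l (word_mul u w).
Proof.
case: u => [|l' u] //= red_u red_w; case: ifP => //= /eqP ->.
by rewrite pushK ?reduced_mul.
Qed.

Lemma word_mulA u v w : reduced v -> reduced w ->
  word_mul u (word_mul v w) = word_mul (word_mul u v) w.
Proof.
by move=> rv rw; elim: u => //= l u ->; rewrite word_mul_push ?reduced_mul.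
Qed.

Lemma word_mul1 u : reduced u -> word_mul u [::] = u.
Proof.
elim: u => //= l u IHu red; rewrite IHu; last exact: path_sorted red.
by case: u red {IHu} => //= l' u /andP[/negbTE ->].
Qed.

Lemma word_mulV_aux u w :
  reduced w -> word_mul (word_inv u) (word_mul u w) = w.
Proof.
move=> red; elim: u => //= l u IHu.
rewrite /word_inv /= rev_cons -cats1 /word_mul foldr_cat /=.
have := @pushK (letter_inv l) (foldr push w u) (reduced_mul u red).
by rewrite letter_invK => ->.
Qed.

Definition fg_one : free_group := @FreeGroup [::] isT.
Definition fg_mul (x y : free_group) : free_group :=
  FreeGroup (reduced_mul x (fg_reduced y)).
Definition fg_inv (x : free_group) : free_group :=
  FreeGroup (reduced_inv (fg_reduced x)).

Lemma fg_mulA : associative fg_mul.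
Proof. by move=> x y z; apply/val_inj/word_mulA; apply: fg_reduced. Qed.
Lemma fg_mul1g : left_id fg_one fg_mul.
Proof. by move=> x; apply: val_inj. Qed.
Lemma fg_mulg1 : right_id fg_one fg_mul.
Proof. by move=> x; apply/val_inj/word_mul1/fg_reduced. Qed.
Lemma fg_mulVg : left_inverse fg_one fg_inv fg_mul.
Proof.
move=> x; apply: val_inj => /=.
by rewrite -[in X in word_mul _ X](word_mul1 (fg_reduced x)) word_mulV_aux.
Qed.
Lemma fg_invK : involutive fg_inv.
Proof.
move=> x; apply: val_inj; rewrite /= /word_inv map_rev revK -map_comp.
by rewrite (eq_map letter_invK) map_id.
Qed.
Lemma fg_mulgV : right_inverse fg_one fg_inv fg_mul.
Proof. by move=> x; rewrite -{1}(fg_invK x) fg_mulVg. Qed.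

HB.instance Definition _ :=
  isGroup.Build free_group fg_mulA fg_mul1g fg_mulg1 fg_mulVg fg_mulgV.

Definition fg_gen (a : A) : free_group := @FreeGroup [:: (a, false)] isT.

End FreeGroup.

Section FreeGroupUniversal.
Variables (A : choiceType) (G : groupType) (f : A -> G).
Local Open Scope group_scope.

Definition letter_eval (l : letter A) : G := if l.2 then (f l.1)^-1 else f l.1.

Definition fg_lift (x : free_group A) : G :=
  foldr (fun l g => letter_eval l * g) 1 (fg_word x).

Lemma fg_lift_gen a : fg_lift (fg_gen a) = f a.
Proof. by rewrite /fg_lift /= mulg1. Qed.

Lemma fg_liftM : {morph fg_lift : x y / x * y}.
Proof.
move=> [u ru] [v rv]; rewrite /fg_lift /= {ru rv}.
have evalV l : letter_eval (letter_inv l) = (letter_eval l)^-1.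
  by case: l => a [] //; rewrite /letter_eval /= invgK.
elim: u => [|l u IHu] /=; first by rewrite mul1g.
rewrite -mulgA -IHu; case: (word_mul u v) => [|l' w] //=.
by case: ifP => //= /eqP ->; rewrite evalV mulVKg.
Qed.

Lemma fg_lift_unique (h : free_group A -> G) :
  {morph h : x y / x * y} -> (forall a, h (fg_gen a) = f a) -> h =1 fg_lift.
Proof.
move=> hM hf.
have h1 : h 1 = 1 by apply: (@mulgI _ (h 1)); rewrite -hM !mulg1.
have hV x : h x^-1 = (h x)^-1.
  by apply: (@mulgI _ (h x)); rewrite -hM !mulgV.
case=> w; elim: w => [|l w IHw] red.
  by rewrite -[RHS]/(1 : G) -h1; congr h; apply: val_inj.
have rw : reduced w by exact: path_sorted red.
rewrite /fg_lift /= -[foldr _ _ w]/(fg_lift (FreeGroup rw)) -IHw.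
have hl : h (@FreeGroup A [:: l] isT) = letter_eval l.
  case: l {red} => a []; rewrite /letter_eval /= -hf // -hV.
  by congr h; apply: val_inj.
rewrite -hl -hM; congr h; apply: val_inj => /=.
by case: w red {IHw rw} => //= l' w /andP[/negbTE ->].
Qed.

End FreeGroupUniversal.

Record normalSubgroup (G : groupType) := NormalSubgroup {
  nsg :> {pred G};
  nsg_closed : group_closed nsg;
  nsg_conj : forall x y : G, x \in nsg -> (x ^ y)%g \in nsg }.

Section Quotient.
Variables (G : groupType) (N : normalSubgroup G).
Local Open Scope group_scope.

Definition same_coset (x y : G) : bool := x^-1 * y \in N.

Lemma same_coset_refl : reflexive same_coset.
Proof. by move=> x; rewrite /same_coset mulVg (nsg_closed N).1. Qed.

Lemma same_coset_sym : symmetric same_coset.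
Proof.
have sub x y : same_coset x y -> same_coset y x.
  by move=> /(group_closedV (nsg_closed N)); rewrite invgM invgK.
by move=> x y; apply/idP/idP; apply: sub.
Qed.

Lemma same_coset_trans : transitive same_coset.
Proof.
move=> y x z xy /(group_closedM (nsg_closed N) xy).
by rewrite mulgA mulgK.
Qed.

Canonical same_coset_equiv :=
  EquivRel same_coset same_coset_refl same_coset_sym same_coset_trans.

Definition quotient_group := {eq_quot same_coset}.

HB.instance Definition _ := Choice.on quotient_group.
HB.instance Definition _ := EqQuotient.on quotient_group.

Definition quot_mul : quotient_group -> quotient_group -> quotient_group :=
  lift_op2 quotient_group (fun x y : G => x * y).
Definition quot_inv : quotient_group -> quotient_group :=
  lift_op1 quotient_group (fun x : G => x^-1).
Definition quot_one : quotient_group := lift_cst quotient_group 1.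

Lemma same_coset_mul x x' y y' :
  same_coset x x' -> same_coset y y' -> same_coset (x * y) (x' * y').
Proof.
move=> xx' yy'; rewrite /same_coset.
have -> : (x * y)^-1 * (x' * y') = (x^-1 * x') ^ y * (y^-1 * y').
  by rewrite /conjg invgM !mulgA mulgK.
by apply: (group_closedM (nsg_closed N)) => //; apply: nsg_conj.
Qed.

Lemma same_coset_inv x x' : same_coset x x' -> same_coset x^-1 x'^-1.
Proof.
move=> /(group_closedV (nsg_closed N)) /(nsg_conj x^-1).
by rewrite /same_coset /conjg !invgM !invgK mulgA mulgA mulgK.
Qed.

Lemma pi_quot_mul : {morph \pi_quotient_group : x y / x * y >-> quot_mul x y}.
Proof.
move=> x y; unlock quot_mul; apply/eqmodP => /=.
by apply: same_coset_mul; rewrite -/(same_coset_equiv _ _) -eqmodE reprK.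
Qed.

Lemma pi_quot_inv : {morph \pi_quotient_group : x / x^-1 >-> quot_inv x}.
Proof.
move=> x; unlock quot_inv; apply/eqmodP => /=.
by apply: same_coset_inv; rewrite -/(same_coset_equiv _ _) -eqmodE reprK.
Qed.

Lemma pi_quot_one : \pi_quotient_group 1 = quot_one.
Proof. by unlock quot_one. Qed.

Lemma quot_mulA : associative quot_mul.
Proof.
by elim/quotW=> x; elim/quotW=> y; elim/quotW=> z; rewrite -!pi_quot_mul mulgA.
Qed.
Lemma quot_mul1g : left_id quot_one quot_mul.
Proof. by elim/quotW=> x; rewrite -pi_quot_one -pi_quot_mul mul1g. Qed.
Lemma quot_mulg1 : right_id quot_one quot_mul.
Proof. by elim/quotW=> x; rewrite -pi_quot_one -pi_quot_mul mulg1. Qed.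
Lemma quot_mulVg : left_inverse quot_one quot_inv quot_mul.
Proof.
by elim/quotW=> x; rewrite -pi_quot_inv -pi_quot_mul mulVg pi_quot_one.
Qed.
Lemma quot_mulgV : right_inverse quot_one quot_inv quot_mul.
Proof.
by elim/quotW=> x; rewrite -pi_quot_inv -pi_quot_mul mulgV pi_quot_one.
Qed.

HB.instance Definition _ := isGroup.Build quotient_group
  quot_mulA quot_mul1g quot_mulg1 quot_mulVg quot_mulgV.

Definition quot_map (x : G) : quotient_group := \pi_quotient_group x.

Lemma quot_mapM : {morph quot_map : x y / x * y}.
Proof. exact: pi_quot_mul. Qed.

Lemma quot_map_eq x y : (quot_map x == quot_map y) = (x^-1 * y \in N).
Proof. exact: eqmodE. Qed.

End Quotient.

Definition generates (G : groupType) (S : seq G) : Prop :=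
  forall H : {pred G}, group_closed H -> {subset S <= H} -> forall x, x \in H.

Definition is_filtration (G : groupType) (N : nat -> normalSubgroup G) : Prop :=
  [/\ forall i, {subset N i.+1 <= N i},
      forall i, finite_set [set: quotient_group (N i)]
    & forall x, (forall i, x \in N i) -> x = 1%g].

Section CayleyMetric.
Variables (R : realType) (G : groupType) (S : seq G).

Definition cayley_edge (x y : G) : bool :=
  has (fun s => (y == x * s)%g || (x == y * s)%g) S.

(* The infimum is a minimum as soon as [x] and [y] are joined by a path, which
   is always the case when [S] generates [G]. *)
Definition cayley_dist (x y : G) : R :=
  inf [set (size p)%:R | p in [set p | path cayley_edge x p /\ last x p = y]].

Definition cayley_diam : R :=
  sup [set cayley_dist z.1 z.2 | z in [set: G * G]].

End CayleyMetric.

(* The components are the quotients [G / N i] with their Cayley graph metrics,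
   and distinct components lie at distance the sum of their diameters.  Two
   components may both be trivial, hence at distance 0 from each other. *)
Section BoxSpace.
Variables (R : realType) (G : groupType) (S : seq G).
Variable N : nat -> normalSubgroup G.

Definition box_space : Type := {i : nat & quotient_group (N i)}.

Definition box_gens (i : nat) : seq (quotient_group (N i)) :=
  map (@quot_map G (N i)) S.

(* [tagged_as x y] is the point of [y], cast to the component of [x]. *)
Definition box_dist (x y : box_space) : R :=
  if tag x == tag y then
    cayley_dist R (box_gens (tag x)) (tagged x) (tagged_as x y)
  else cayley_diam R (box_gens (tag x)) + cayley_diam R (box_gens (tag y)).

End BoxSpace.

Section Coarse.
Variable R : realType.

(* Properness of a (not necessarily continuous) self-map of the nonnegative
   reals in the coarse sense: preimages of bounded sets are bounded.  Values at
   negative arguments are irrelevant. *)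
Definition proper_nneg (rho : R -> R) : Prop :=
  (forall t, 0 <= t -> 0 <= rho t) /\
  (forall B : set R, bounded_set B -> bounded_set [set t | 0 <= t /\ B (rho t)]).

Variables (X Y : Type) (dX : X -> X -> R) (dY : Y -> Y -> R).

Definition coarse_embedding (phi : X -> Y) : Prop :=
  exists rho_m rho_p : R -> R,
    [/\ proper_nneg rho_m, proper_nneg rho_p
      & forall a b, rho_m (dX a b) <= dY (phi a) (phi b) <= rho_p (dX a b)].

Definition coarse_equivalence (phi : X -> Y) : Prop :=
  coarse_embedding phi /\
  exists C : R, 0 < C /\ forall y, exists x, dY y (phi x) <= C.

Definition coarsely_equivalent : Prop := exists phi, coarse_equivalence phi.

End Coarse.

(* Main.v *)
(* Let p be the least prime divisor of n - 1. The quotients G = F_n / N_i are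
   p-groups of large girth, and N_i is cut out by d homomorphisms to the integers
   modulo rapidly increasing powers of p. As a result the first rational cohomology
   of the Cayley graph of G with the loops of length at most r filled in drops from
   dimension d to 0 one dimension at a time, at widely separated scales r. Here
   d = n if p is odd; if p = 2, homomorphisms twisted by sign characters are used as
   well and d = n ^ 2.

   A coarse equivalence with a box space of F_m yields, far out, quasi-isometries
   with uniform constants between some H = F_m / M_j and some G. Comparing first
   Betti numbers gives (n - 1) |G| = (m - 1) |H|. Since |G| is a power of p and
   m - 1 is prime to n - 1, this forces m = 2 and |H| = (n - 1) |G|. The
   quasi-isometry carries the flag of cohomology classes over to H. There H acts on
   the one-dimensional graded pieces by signs, so squares act trivially on them. By
   averaging, d is at most the number of edges of the Cayley graph of H modulo the
   subgroup generated by squares. That graph has at most 2 * 4 < n ^ 2 edges, and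
   only 2 < n if |H| is odd, which holds when p is odd. *)

From HB Require Import structures.
From mathcomp Require Import all_boot all_order all_algebra all_fingroup cyclic.
From mathcomp Require Import zify lra.
From mathcomp Require Import all_classical all_reals all_analysis.
Require Import Defs.

Set Implicit Arguments.
Unset Strict Implicit.
Unset Printing Implicit Defensive.

Import Order.TTheory GroupScope GRing.Theory Num.Theory numFieldNormedType.Exports.

(** * Words and integrals of cochains *)

(** Above a fixed scale the Cayley graph of $G$ looks like a $d$-dimensional torus with sides of
    very different lengths, and a class dies when its side is filled in. The lengths can be chosen
    only if the scale from which on all other cohomology is dead is known beforehand; linear algebra
    provides such a scale, independent of the lengths. Nothing relates the multiplications of $G$
    and $H$. However, the space of cochains on $H$ that vanish on short loops is invariant under
    $H$, and on a one-dimensional graded piece a group element acts by a rational root of unity,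
    hence by a sign; on larger pieces there would be no such control. A quasi-isometry with constant
    $A$ blurs scales by a factor $A^2$, and $A$ is not known in advance, so the plateaus between two
    drops become longer at each stage of the tower. The least prime divisor is taken so that $n -
    1$, and with it $|H|$, is odd when $p$ is. For $p = 2$ and $n = 3$ the ordinary homomorphisms
    give only $d = 3$, below the bound 8; the twisted ones raise it to 9. *)

Section Words.
Variables (A : choiceType) (G : groupType) (f : A -> G).
Implicit Types (w u v : seq (letter A)) (x y : G).

Definition word_eval w : G := foldr (fun l g => letter_eval f l * g) 1 w.

Lemma fg_liftE (x : free_group A) : fg_lift f x = word_eval x.
Proof. by []. Qed.

Lemma letter_eval_inv l : letter_eval f (letter_inv l) = (letter_eval f l)^-1.
Proof. by case: l => a [] //; rewrite /letter_eval /= invgK. Qed.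

Lemma word_eval_cat u v : word_eval (u ++ v) = word_eval u * word_eval v.
Proof. by elim: u => [|l u IH] /=; rewrite ?mul1g // IH mulgA. Qed.

Lemma word_eval_rcons u l : word_eval (rcons u l) = word_eval u * letter_eval f l.
Proof. by rewrite -cats1 word_eval_cat /= mulg1. Qed.

Lemma word_inv_cons l w : word_inv (l :: w) = rcons (word_inv w) (letter_inv l).
Proof. by rewrite /word_inv /= rev_cons. Qed.

Lemma word_invK w : word_inv (word_inv w) = w.
Proof.
rewrite /word_inv map_rev revK -map_comp (eq_map (@letter_invK A)).
exact: map_id.
Qed.

Lemma size_word_inv w : size (word_inv w) = size w.
Proof. by rewrite /word_inv size_rev size_map. Qed.

Lemma word_eval_inv w : word_eval (word_inv w) = (word_eval w)^-1.
Proof.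
elim: w => [|l w IH]; first by rewrite /= invg1.
by rewrite word_inv_cons word_eval_rcons IH letter_eval_inv /= invgM.
Qed.

Lemma word_eval_push l w : word_eval (push l w) = letter_eval f l * word_eval w.
Proof.
case: w => [|l' w] //=; case: eqP => //= ->.
by rewrite letter_eval_inv mulVKg.
Qed.

Definition generated := forall x, exists w, word_eval w = x.

Definition girth_gt r :=
  forall w, reduced w -> size w <= r -> word_eval w = 1 -> w = [::].

End Words.

Section Integral.
Variables (A : choiceType) (G : groupType) (f : A -> G) (V : zmodType).
Implicit Types (w u v : seq (letter A)) (x y : G) (c : G -> A -> V).

Definition step c x (l : letter A) : V :=
  if l.2 then (- c (x * (f l.1)^-1)%g l.1)%R else c x l.1.

Fixpoint integral c x w : V :=
  if w is l :: w' then (step c x l + integral c (x * letter_eval f l)%g w')%R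
  else 0%R.

Lemma step_inv c x l :
  step c (x * letter_eval f l) (letter_inv l) = (- step c x l)%R.
Proof.
by case: l => a []; rewrite /step /letter_eval /= ?mulgK // GRing.opprK.
Qed.

Lemma integral_cat c x u v :
  integral c x (u ++ v) = (integral c x u + integral c (x * word_eval f u)%g v)%R.
Proof.
elim: u x => [|l u IH] x /=; first by rewrite mulg1 GRing.add0r.
by rewrite IH -GRing.addrA mulgA.
Qed.

Lemma integral_push c x l w :
  integral c x (push l w) =
  (step c x l + integral c (x * letter_eval f l)%g w)%R.
Proof.
case: w => [|l' w] //=; case: eqP => //= ->.
by rewrite step_inv letter_eval_inv mulgK GRing.addrA GRing.subrr GRing.add0r.
Qed.

Lemma integral_word_inv c x w :
  integral c (x * word_eval f w) (word_inv w) = (- integral c x w)%R.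
Proof.
elim: w x => [|l w IH] x; first by rewrite /= GRing.oppr0.
rewrite word_inv_cons -cats1 integral_cat /= mulgA IH GRing.addr0.
by rewrite word_eval_inv mulgK step_inv GRing.opprD GRing.addrC.
Qed.

End Integral.

Section Reduce.
Variable A : choiceType.
Implicit Types (w u v : seq (letter A)).

Definition reduce w : seq (letter A) := word_mul w [::].

Lemma reduced_reduce w : reduced (reduce w).
Proof. exact: reduced_mul. Qed.

Lemma size_push (l : letter A) w : size (push l w) <= (size w).+1.
Proof. by case: w => [|l' w] //=; case: ifP => //= _; lia. Qed.

Lemma size_reduce w : size (reduce w) <= size w.
Proof.
elim: w => [|l w IH] //=; apply: leq_trans (size_push _ _) _; exact: IH.
Qed.

Lemma word_eval_reduce (G : groupType) (f : A -> G) w :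
  word_eval f (reduce w) = word_eval f w.
Proof. by elim: w => [|l w IH] //=; rewrite word_eval_push IH. Qed.

Lemma integral_reduce (G : groupType) (f : A -> G) (V : zmodType) 
  (c : G -> A -> V) x w : integral f c x (reduce w) = integral f c x w.
Proof. by elim: w x => [|l w IH] x //=; rewrite integral_push IH. Qed.

Lemma reduce_id w : reduced w -> reduce w = w.
Proof. exact: word_mul1. Qed.

Definition fg_of_word w : free_group A := FreeGroup (reduced_reduce w).

End Reduce.

(** * Linear algebra *)

Section LinearAlgebra.
Local Open Scope ring_scope.
Variables (K : fieldType).

(** Greedy choice of vectors, with the missing dimension as fuel. [P] is an arbitrary predicate:
    [finite_vanishing_test] applies this to a set of exponent vectors. *)
Lemma finite_spanning (vT : vectType K) (P : vT -> Prop) :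
  exists s : seq vT, (forall v, v \in s -> P v) /\ (forall v, P v ->
    v \in << s >>%VS).
Proof.
suff H (k : nat) (s : seq vT) : (forall v, v \in s -> P v) ->
    (\dim {:vT} <= \dim << s >> + k)%N ->
    exists s' : seq vT, (forall v, v \in s' -> P v) /\
      (forall v, P v -> v \in << s' >>%VS).
  by apply: (H (\dim {:vT}) [::]) => //; lia.
elim: k s => [|k IH] s Ps ds.
  exists s; split => // v _; suff -> : << s >>%VS = fullv by exact: memvf.
  by apply/eqP; rewrite eqEdim subvf; lia.
case: (pselect (forall v, P v -> v \in << s >>%VS)) =>
  [|/existsNP[v /not_implyP[Pv vs]]].
  by exists s.
apply: (IH (v :: s)).
  by move=> u; rewrite inE => /orP[/eqP ->|/Ps].
suff : (\dim << s >> < \dim <<v :: s>>)%N by lia.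
rewrite ltn_neqAle dimvS ?andbT; last by rewrite span_cons addvSr.
apply/negP => /eqP e; apply: vs.
have /eqP -> : << s >>%VS == <<v :: s>>%VS by rewrite eqEdim span_cons addvSr
  -span_cons e leqnn.
by rewrite memv_span ?inE ?eqxx.
Qed.

Lemma span_ind (vT : vectType K) (s : seq vT) (P : vT -> Prop) :
  P 0 -> (forall a u v, P u -> P v -> P (a *: u + v)) ->
  (forall v, v \in s -> P v) -> forall v, v \in << s >>%VS -> P v.
Proof.
move=> P0 PZD sP v vs; rewrite (@coord_span _ _ _ (in_tuple s) v vs).
elim/big_ind : _ => [//|u w Pu Pw|i _]; first by rewrite -[u]scale1r; apply: PZD.
by rewrite -[_ *: _]addr0; apply: PZD => //; apply: sP; apply: mem_nth.
Qed.

Lemma vspace_of_closed (vT : vectType K) (P : vT -> Prop) :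
  P 0 -> (forall a u v, P u -> P v -> P (a *: u + v)) ->
  exists U : {vspace vT}, forall v, v \in U <-> P v.
Proof.
move=> P0 PZD; have [s [sP Ps]] := finite_spanning P.
by exists << s >>%VS => v; split; [apply: span_ind|apply: Ps].
Qed.

(** Differences of dimensions replace quotient spaces: [g0] is injective modulo [B'] on a complement
    of [B] in [U]. *)
Lemma leq_dim_relative (vT wT : vectType K) (g0 : vT -> wT)
    (U B : {vspace vT}) (U' B' : {vspace wT}) :
  linear g0 -> (B <= U)%VS -> (B' <= U')%VS ->
  (forall v, v \in U -> g0 v \in U') ->
  (forall v, v \in U -> g0 v \in B' -> v \in B) ->
  (\dim U - \dim B <= \dim U' - \dim B')%N.
Proof.
move=> lin_g BU BU' g0U g0B.
pose gM := GRing.isLinear.Build _ _ _ _ g0 lin_g.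
pose g := linfun (HB.pack g0 gM : {linear vT -> wT}).
have gU v : v \in U -> g v \in U' by rewrite lfunE; apply: g0U.
have gB v : v \in U -> g v \in B' -> v \in B by rewrite lfunE; apply: g0B.
set X := (U :\: B)%VS.
have XU : (X <= U)%VS by rewrite diffvSl.
have dX : (\dim X = \dim U - \dim B)%N.
  have := dimv_cap_compl U B; have /capv_idPr -> := BU; rewrite -/X; lia.
have XB : (X :&: B = 0)%VS by exact: capv_diff.
have kX : (lker g :&: X = 0)%VS.
  apply/eqP; rewrite -subv0; apply/subvP => v; rewrite memv_cap memv_ker.
  move=> /andP[/eqP gv0 vX]; rewrite -XB memv_cap vX /=.
  by apply: gB; rewrite ?(subvP XU) // gv0 mem0v.
have gXB : (g @: X :&: B' = 0)%VS.
  apply/eqP; rewrite -subv0; apply/subvP => w; rewrite memv_cap.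
  move=> /andP[/memv_imgP[v vX ->] gvB].
  have : v \in (X :&: B)%VS by rewrite memv_cap vX gB // (subvP XU).
  by rewrite XB memv0 => /eqP ->; rewrite linear0 mem0v.
have dgX : \dim (g @: X) = \dim X.
  by have := limg_ker_dim g X; rewrite capvC kX dimv0 add0n.
have : (g @: X + B' <= U')%VS.
  rewrite subv_add BU' andbT; apply/subvP => w /memv_imgP[v vX ->].
  by apply: gU; apply: (subvP XU).
move/dimvS; rewrite dimv_disjoint_sum //.
by rewrite -dX -dgX => h; lia.
Qed.

End LinearAlgebra.

(** * Cochains on finite Cayley graphs *)

Lemma dim_ffun (I : finType) : \dim {: {ffun I -> rat^o}} = #|I|.
Proof. by rewrite dimvf; apply: muln1. Qed.

Section Cochains.
Variables (m : nat) (G : finGroupType) (f : 'I_m -> G).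
Implicit Types (w : seq (letter 'I_m)) (x : G).

Definition cochain := {ffun G * 'I_m -> rat^o}.

Definition line_integral (c : cochain) x w : rat :=
  integral f (fun y a => c (y, a) : rat) x w.

Local Notation J := line_integral.

Lemma line_integral_cat c x u v :
  J c x (u ++ v) = (J c x u + J c (x * word_eval f u)%g v)%R.
Proof. exact: integral_cat. Qed.

Lemma line_integral_linear x w : linear (fun c : cochain => J c x w : rat^o).
Proof.
move=> k c c'; rewrite /J; elim: w x => [|[a b] w IH] x /=.
  by rewrite addr0 scaler0.
rewrite IH /step /=; case: b; rewrite /= !ffunE /= /GRing.scale /=.
  by rewrite mulrDr opprD mulrN !addrA; congr (_ + _)%R; rewrite addrAC.
by rewrite mulrDr !addrA; congr (_ + _)%R; rewrite addrAC.
Qed.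

Lemma line_integral0 x w : J 0%R x w = 0%R.
Proof.
have := line_integral_linear x w 1%R 0%R 0%R.
by rewrite !scale1r addr0 -[LHS]addr0 => /addrI.
Qed.

Lemma line_integral_sum (I : finType) (b : I -> rat) (C : I -> cochain) x w :
  J (\sum_i b i *: C i)%R x w = (\sum_i b i * J (C i) x w)%R.
Proof.
apply: (big_ind2 (fun c q => J c x w = q)) => [|u q v r <- <-|i _].
- exact: line_integral0.
- by have := line_integral_linear x w 1%R u v; rewrite !scale1r.
- by have := line_integral_linear x w (b i) (C i) 0%R; rewrite line_integral0 !addr0.
Qed.

Definition coboundary_fun (u : {ffun G -> rat^o}) : cochain :=
  [ffun p => u (p.1 * f p.2)%g - u p.1]%R.

Fact coboundary_is_linear : linear coboundary_fun.
Proof.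
move=> k u v; apply/ffunP => -[x a]; rewrite !ffunE /= scalerBr opprD !addrA.
by congr (_ + _)%R; rewrite addrAC.
Qed.

HB.instance Definition _ :=
  GRing.isLinear.Build rat _ _ _ coboundary_fun coboundary_is_linear.

Definition coboundaries : {vspace cochain} := limg (linfun coboundary_fun).

Lemma coboundariesP (c : cochain) :
  c \in coboundaries <->
  exists u : G -> rat, forall x a, c (x, a) = (u (x * f a)%g - u x)%R.
Proof.
split=> [/memv_imgP[u _ ->]|[u cu]].
  by exists u => x a; rewrite lfunE ffunE.
apply/memv_imgP; exists [ffun x => u x : rat^o]; first exact: memvf.
by apply/ffunP => -[x a]; rewrite lfunE !ffunE cu.
Qed.

Lemma line_integral_exact (c : cochain) (u : G -> rat) x w :
  (forall x a, c (x, a) = (u (x * f a)%g - u x)%R) ->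
  J c x w = (u (x * word_eval f w)%g - u x)%R.
Proof.
move=> cu; elim: w x => [|[a b] w IH] x; first by rewrite /= mulg1 subrr.
rewrite /J /= -/(J _ _ _) IH mulgA /step /=; case: b; rewrite /letter_eval /= cu.
  by rewrite mulgVK opprB addrC addrA subrK.
by rewrite addrC addrA subrK.
Qed.

(** The graph is connected, so only constants have zero coboundary. *)
Lemma dim_coboundaries : generated f -> (\dim coboundaries).+1 = #|G|.
Proof.
move=> gen; have := limg_ker_dim (linfun coboundary_fun) fullv.
have -> : (fullv :&: lker (linfun coboundary_fun))%VS = <[[ffun=> 1%R : rat^o]]>%VS.
  apply/vspaceP => u; rewrite memv_cap memvf /= memv_ker lfunE.
  apply/eqP/vlineP => [/ffunP u0|[k ->]]; last first.
    by apply/ffunP => p; rewrite !ffunE subrr.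
  exists (u 1%g); apply/ffunP => x; rewrite !ffunE.
  have [w <-] := gen x.
  have : J 0%R 1 w = (u (1 * word_eval f w)%g - u 1%g)%R.
    by apply: line_integral_exact => y a; have := u0 (y, a); rewrite !ffunE /= => ->.
  rewrite line_integral0 mul1g => /esym/eqP; rewrite subr_eq0 => /eqP ->.
  by rewrite /GRing.scale /= mulr1.
rewrite dim_vline -/coboundaries dim_ffun.
suff -> : [ffun=> 1%R : rat^o] != 0%R :> {ffun G -> rat^o} by rewrite add1n.
by apply/eqP => /ffunP/(_ 1%g); rewrite !ffunE.
Qed.

Fact cocycles_key (r : nat) : exists U : {vspace cochain}, forall c, c \in U <->
  forall x w, size w <= r -> word_eval f w = 1 -> J c x w = 0%R.
Proof.
apply: vspace_of_closed => [x w _ _|k c c' c0 c'0 x w sw ew].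
  exact: line_integral0.
by rewrite (line_integral_linear x w) c0 // c'0 // scaler0 addr0.
Qed.

Definition cocycles r : {vspace cochain} := sval (cid (cocycles_key r)).

Lemma cocyclesP r c : c \in cocycles r <->
  forall x w, size w <= r -> word_eval f w = 1 -> J c x w = 0%R.
Proof. by rewrite /cocycles; case: cid. Qed.

Lemma coboundaries_sub r : (coboundaries <= cocycles r)%VS.
Proof.
apply/subvP => c /coboundariesP[u cu]; apply/cocyclesP => x w _ ew.
by rewrite (line_integral_exact x w cu) ew mulg1 subrr.
Qed.

Lemma cocyclesS r r' : r <= r' -> (cocycles r' <= cocycles r)%VS.
Proof.
move=> rr'; apply/subvP => c /cocyclesP cz; apply/cocyclesP => x w sw.
by apply: cz; apply: leq_trans sw rr'.
Qed.

(** A primitive at [x] is the integral along a fixed word from 1 to [x]. *)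
Lemma exact_of_periods c : generated f ->
  (forall w, word_eval f w = 1 -> J c 1 w = 0%R) -> c \in coboundaries.
Proof.
move=> gen c0; apply/coboundariesP.
have [wd wdE] := choice gen.
exists (fun x => J c 1 (wd x)) => x a.
have := c0 (wd x ++ (a, false) :: word_inv (wd (x * f a))).
rewrite !word_eval_cat wdE /= word_eval_inv wdE /letter_eval /=.
rewrite mulgA mulgV => /(_ erefl).
rewrite line_integral_cat wdE mul1g -cat1s line_integral_cat /= mulg1.
have := integral_word_inv f (fun y b => c (y, b) : rat) 1%g (wd (x * f a)).
rewrite mul1g wdE -/(J c _ _) -/(J c _ _) => ->.
rewrite {2}/J /= /step /= addr0 => /eqP.
by rewrite addrA subr_eq0 => /eqP <-; rewrite addrAC subrr add0r.
Qed.

(* The first rational Betti number of the Cayley graph with all loops of length at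
   most [r] filled in. *)
Definition betti r := (\dim (cocycles r) - \dim coboundaries)%N.

(** All loops of length at most [r] are trivial, so every cochain is a cocycle and the count is
    edges minus vertices plus one. *)
Lemma betti_girth r : generated f -> girth_gt f r -> betti r + #|G| = (m * #|G|).+1.
Proof.
move=> gen gir.
have -> : betti r = (m * #|G| - \dim coboundaries)%N.
  rewrite /betti; congr (_ - _)%N.
  have -> : cocycles r = fullv.
    apply/vspaceP => c; rewrite memvf; apply/cocyclesP => x w sw ew.
    rewrite /J -integral_reduce (gir (reduce w)) //.
    - exact: reduced_reduce.
    - exact: leq_trans (size_reduce _) sw.
    - by rewrite word_eval_reduce.
  by rewrite dim_ffun card_prod card_ord mulnC.
rewrite -{2}(dim_coboundaries gen) addnS subnK //.
by have := dimvS (subvf coboundaries); rewrite dim_ffun card_prod card_ord mulnC.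
Qed.

End Cochains.

(** * Lipschitz maps between Cayley graphs *)

Definition near_by (A : choiceType) (G : groupType) (f : A ->
  G) (k : nat) (x y : G) :=
  exists w, size w <= k /\ y = x * word_eval f w.

Section Pullback.
Variables (m n : nat) (H G : finGroupType) (h : 'I_m -> H) (f : 'I_n -> G).
Variables (phi : H -> G) (A : nat) (wd : H -> 'I_m -> seq (letter 'I_n)).
Hypothesis wd_size : forall x a, size (wd x a) <= A.
Hypothesis wd_eval : forall x a, phi (x * h a) = phi x * word_eval f (wd x a).

(** The image under [phi] of the path labelled [w] from [x]. An edge crossed backwards goes to the
    inverse of the word chosen for the edge itself, which is indexed by its other end. *)
Fixpoint transport x (w : seq (letter 'I_m)) : seq (letter 'I_n) :=
  if w is l :: w' then
    (if l.2 then word_inv (wd (x * (h l.1)^-1) l.1) else wd x l.1)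
      ++ transport (x * letter_eval h l) w'
  else [::].

Lemma size_transport x w : size (transport x w) <= A * size w.
Proof.
elim: w x => [|[a b] w IH] x //=; rewrite size_cat mulnS leq_add //.
by case: b; rewrite ?size_word_inv wd_size.
Qed.

Lemma word_eval_transport x w :
  phi x * word_eval f (transport x w) = phi (x * word_eval h w).
Proof.
elim: w x => [|[a b] w IH] x /=; first by rewrite !mulg1.
rewrite word_eval_cat mulgA [X in _ = phi X]mulgA -IH; congr (_ * _).
rewrite /letter_eval; case: b => /=; last by rewrite wd_eval.
rewrite word_eval_inv -{1}(mulgVK (h a) x) wd_eval mulgK //.
Qed.

Definition pullback (c : cochain n G) : cochain m H :=
  [ffun p => line_integral f c (phi p.1) (wd p.1 p.2) : rat^o].

Lemma pullback_linear : linear pullback.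
Proof.
by move=> k c c'; apply/ffunP => -[x a]; rewrite !ffunE (line_integral_linear f).
Qed.

Lemma line_integral_pullback c x w :
  line_integral h (pullback c) x w = line_integral f c (phi x) (transport x w).
Proof.
elim: w x => [|[a b] w IH] x //=.
rewrite line_integral_cat -cat1s line_integral_cat /= mulg1 IH.
congr (_ + _)%R.
  rewrite /line_integral /= /step /= addr0; case: b => /=; rewrite ffunE //=.
  rewrite -(mulgVK (h a) x) wd_eval (mulgVK (h a) x).
  by rewrite (integral_word_inv f (fun y b => c (y, b) : rat)).
congr (line_integral f c _ _).
have := word_eval_transport x [:: (a, b)]; rewrite /= cats0 mulg1 => <-.
done.
Qed.

End Pullback.

Definition lipschitz (m n : nat) (H G : groupType) (h : 'I_m -> H) (f : 'I_n -> G)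
  (A : nat) (phi : H -> G) := forall x a, near_by f A (phi x) (phi (x * h a)).

Lemma lipschitz_words (m n : nat) (H G : groupType) (h : 'I_m -> H)
    (f : 'I_n -> G) A phi : lipschitz h f A phi ->
  exists wd, (forall x a, size (wd x a) <= A) /\
    (forall x a, phi (x * h a) = phi x * word_eval f (wd x a)).
Proof.
move=> lip; have [wd wdP] := choice (fun p => lip p.1 p.2).
by exists (fun x a => wd (x, a)); split=> x a; have [] := wdP (x, a).
Qed.

Section Lipschitz.
Variables (m n : nat) (H G : finGroupType) (h : 'I_m -> H) (f : 'I_n -> G).

(* Pulling back along [phi] is injective on cohomology because [phi \o psi] moves
   points by at most [A], hence induces the identity on classes that vanish on
   loops of length [(A + 1) ^ 2]. *)
Lemma betti_lipschitz A r phi psi :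
  lipschitz h f A phi -> lipschitz f h A psi ->
  (forall y, near_by f A y (phi (psi y))) -> (A + 1) ^ 2 <= A * r ->
  betti f (A * r) <= betti h r.
Proof.
move=> /lipschitz_words[wd [wds wde]] /lipschitz_words[wd' [wds' wde']].
move=> /choice[t tP] Ar.
rewrite /betti; apply: (@leq_dim_relative _ _ _ (pullback f phi wd)).
- exact: pullback_linear.
- exact: coboundaries_sub.
- exact: coboundaries_sub.
-
  move=> c /cocyclesP cz; apply/cocyclesP => x w sw ew.
  rewrite (line_integral_pullback wde) cz //.
    by apply: leq_trans (size_transport _ wds _ _) _; rewrite leq_mul2l sw orbT.
  by apply: (mulgI (phi x)); rewrite (word_eval_transport wde) ew !mulg1.
- move=> c /cocyclesP cz /coboundariesP[v cv]; apply/coboundariesP.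
(* The primitive of the pullback, read at [psi y], is corrected by the integral along the short path
   from [y] to [phi (psi y)]. *)
pose u y := (v (psi y) - line_integral f c y (t y))%R.
exists u => y a.
set W := transport h wd (psi y) (wd' y a).
have eW : phi (psi y) * word_eval f W = phi (psi (y * f a)).
  by rewrite (word_eval_transport wde) wde'.
have JW : line_integral f c (phi (psi y)) W = (v (psi (y * f a)%g) - v (psi y))%R.
  by rewrite -(line_integral_pullback wde) (line_integral_exact _ _ cv) wde'.
have [st et] := tP y; have [st' et'] := tP (y * f a).
(* The loop through [y], [phi (psi y)], [phi (psi (y * f a))] and [y * f a] has length at most
   [A + A * A + A + 1], which is [(A + 1) ^ 2]. *)
have := cz y (t y ++ W ++ word_inv (t (y * f a)) ++ [:: (a, true)]).
have loop_size : size (t y ++ W ++ word_inv (t (y * f a)) ++ [:: (a, true)]) <= A * r.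
  apply: leq_trans Ar; have := size_transport h wds (psi y) (wd' y a).
  rewrite -/W => sW; have sW' : size W <= A * A.
    by apply: leq_trans sW _; rewrite leq_mul2l wds' orbT.
  rewrite !size_cat size_word_inv /= expnS expn1 mulnDl !mulnDr !muln1 mul1n.
  by rewrite addnCA -(addnA (A * A)%N) leq_add // leq_add // leq_add2r.
have loop_eval : word_eval f (t y ++ W ++ word_inv (t (y * f a)) ++ [:: (a,
  true)]) = 1.
  rewrite !word_eval_cat word_eval_inv /=.
  apply: (mulgI y); rewrite !mulgA -et eW et' mulgK /letter_eval /= mulg1.
  by rewrite mulgK mulg1.
move=> /(_ loop_size loop_eval).
rewrite !line_integral_cat -et eW JW et'.
have := integral_word_inv f (fun z b => c (z, b) : rat) (y * f a) (t (y * f a)).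
rewrite -/(line_integral f c _ _) -/(line_integral f c _ _) => ->.
rewrite word_eval_inv mulgK.
have -> : line_integral f c (y * f a) [:: (a, true)] = (- c (y, a) : rat)%R.
  by rewrite /line_integral /= /step /= mulgK addr0.
have calc (q1 q2 q3 q4 q5 : rat) :
  (q1 + (q2 - q3 + (- q4 - q5)) = 0 -> q5 = q2 - q4 - (q3 - q1))%R by lra.
exact: calc.
Qed.

End Lipschitz.

(** * Flags of invariant spaces of cochains *)

Lemma rat_root_of_unity (mu : rat) N : 0 < N -> (mu ^+ N = 1 -> mu ^+ 2 = 1)%R.
Proof.
move=> N0 muN; have /eqP : (`|mu| ^+ N = 1)%R by rewrite -normrX muN normr1.
by rewrite pexpr_eq1 // -(real_normK (num_real mu)) => /eqP ->; rewrite expr1n.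
Qed.

Section Translation.
Variables (m : nat) (H : finGroupType).
Implicit Types (c : cochain m H) (x y : H).

(** Edges are right multiplications by generators, so left multiplication is an automorphism of the
    labelled graph. *)
Definition translate x c : cochain m H := [ffun p => c (x * p.1, p.2)].

Fact translate_is_linear x : linear (translate x).
Proof. by move=> k u v; apply/ffunP => p; rewrite !ffunE. Qed.

HB.instance Definition _ x :=
  GRing.isLinear.Build rat _ _ _ (translate x) (translate_is_linear x).

Lemma translateM x y c : translate (x * y) c = translate y (translate x c).
Proof. by apply/ffunP => -[z a]; rewrite !ffunE /= mulgA. Qed.

Lemma translate1 c : translate 1 c = c.
Proof. by apply/ffunP => -[z a]; rewrite !ffunE /= mul1g. Qed.

Lemma translateZ x (t : rat) c : (translate x (t *: c) = t *: translate x c)%R.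
Proof. exact: linearZ_LR. Qed.

Lemma translateB x c c' : (translate x (c - c') = translate x c - translate x c')%R.
Proof. exact: linearB. Qed.

Definition square_group : {group H} := <<[set (x * x)%g | x : H]>>%G.

Lemma square_group_ind (P : H -> Prop) : P 1 ->
  (forall x y, P y -> P (x * x * y)) -> forall x, x \in square_group -> P x.
Proof.
move=> P1 PM x /gen_prodgP[n [c cA ->]].
elim: n c cA => [|n IH] c cA; first by rewrite big_ord0.
rewrite big_ord_recl; have /imsetP[y _ ->] := cA ord0; apply: PM.
by apply: IH => i; apply: cA.
Qed.

Section Flag.
Variable W : nat -> {vspace cochain m H}.
Hypothesis W_translate : forall k x c, c \in W k -> translate x c \in W k.
Hypothesis W_sub : forall k, (W k.+1 <= W k)%VS.
Hypothesis W_dim : forall k, \dim (W k) <= (\dim (W k.+1)).+1.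

(* A group element of finite order acts on the at most one-dimensional rational
   space [W k / W k.+1] by a root of unity, that is, by a sign. *)
Lemma translate_square k x c :
  c \in W k -> (translate (x * x) c - c)%R \in W k.+1.
Proof.
move=> cW; case: (boolP (W k <= W k.+1)%VS) => [sub|/subvPn[v vW vW']].
  by apply: (subvP sub); rewrite rpredB // W_translate.
have spanW : (W k <= <[v]> + W k.+1)%VS.
  have sub : (<[v]> + W k.+1 <= W k)%VS by rewrite subv_add W_sub -memvE vW.
  suff /eqP -> : (<[v]> + W k.+1)%VS == W k by [].
  rewrite eqEdim sub /=; apply: leq_trans (W_dim k) _.
  rewrite dimv_disjoint_sum ?dim_vline; last first.
    apply/eqP; rewrite -subv0; apply/subvP => u; rewrite memv_cap.
    move=> /andP[/vlineP[t ->]]; case: (t =P 0%R) => [-> _|/eqP t0].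
      by rewrite scale0r mem0v.
    by rewrite rpredZeq (negbTE t0) (negbTE vW').
  suff -> : v != 0%R by rewrite add1n.
  by apply: contra vW' => /eqP ->; rewrite mem0v.
have spanP u : u \in W k -> exists mu, (u - mu *: v)%R \in W k.+1.
  move=> /(subvP spanW)/memv_addP[_ /vlineP[mu ->] [w wW' ->]].
  by exists mu; rewrite addrAC subrr add0r.
have [mu muP] := spanP _ (W_translate x vW).
(* [mu] is the eigenvalue of [x] on the quotient line; taking [j] to be the order of the group shows
   that it is a root of unity. *)
have pow j : (translate (x ^+ j) v - mu ^+ j *: v)%R \in W k.+1.
  elim: j => [|j IH]; first by rewrite expg0 expr0 scale1r translate1 subrr mem0v.
  have -> : (translate (x ^+ j.+1) v - mu ^+ j.+1 *: v =
      translate x (translate (x ^+ j) v - mu ^+ j *: v)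
      + mu ^+ j *: (translate x v - mu *: v))%R.
    by rewrite expgSr translateM translateB translateZ scalerBr scalerA exprSr addrA
      subrK.
  by apply: memvD; [exact: W_translate IH|exact: memvZ muP].
have mu2 : (mu ^+ 2 = 1)%R.
  apply: (@rat_root_of_unity _ #|H|); first by apply/card_gt0P; exists 1.
  apply/eqP; apply/negPn/negP => mu1; move/negP: vW'; apply.
  have := pow #|H|; have -> : x ^+ #|H| = 1 by rewrite -cardsT expg_cardG ?inE.
  rewrite translate1 -{1}[v]scale1r -scalerBl rpredZeq subr_eq0.
  by rewrite eq_sym (negbTE mu1).
have [nu nuP] := spanP _ cW.
have -> : (translate (x * x) c - c = translate (x * x) (c - nu *: v) - (c - nu *: v)
   + nu *: (translate (x * x) v - v))%R.
  rewrite translateB translateZ scalerBr opprB.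
  by rewrite -addrA [(nu *: v - c + _)%R]addrC !addrA !subrK.
apply: rpredD; first by apply: rpredB => //; apply: W_translate.
apply: rpredZ.
by have := pow 2; rewrite mu2 scale1r expgS expg1.
Qed.

Lemma translate_square_group k x c : x \in square_group ->
  c \in W k -> (translate x c - c)%R \in W k.+1.
Proof.
move=> xH; elim/square_group_ind : x / xH c => [|x y IH] c cW.
  by rewrite translate1 subrr mem0v.
have -> : (translate (x * x * y) c - c =
   translate y (translate (x * x) c - c) + (translate y c - c))%R.
  by rewrite translateM translateB addrA subrK.
by rewrite rpredD ?IH // W_translate // translate_square.
Qed.

Definition average c : cochain m H :=
  (#|square_group|%:R^-1 *: \sum_(x in square_group) translate x c)%R.

Lemma translate_average y c : y \in square_group ->
  translate y (average c) = average c.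
Proof.
move=> yH; rewrite /average translateZ linear_sum /=; congr (_ *: _)%R.
rewrite [RHS](reindex_inj (mulIg y)) /=.
by apply: eq_big => [x|x _]; rewrite ?groupMr // translateM.
Qed.

Lemma sub_average k c : c \in W k -> (c - average c)%R \in W k.+1.
Proof.
move=> cW; have card0 : (#|square_group|%:R != 0 :> rat)%R.
  by rewrite pnatr_eq0 -lt0n cardG_gt0.
have -> : (c - average c = #|square_group|%:R^-1 *:
    \sum_(x in square_group) (c - translate x c))%R.
  rewrite sumrB scalerBr sumr_const -scaler_nat scalerA mulVf ?scale1r //.
rewrite rpredZ // rpred_sum // => x xH.
by rewrite -opprB rpredN translate_square_group.
Qed.

(** Averaging changes an element of [W k] only by an element of [W k.+1], so [W 0] lies in the
    invariant cochains plus [W d]. An invariant cochain is determined by its values on the edges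
    that start in [R]. *)
Lemma dim_flag d (R : seq H) :
  (forall x, exists s r, [/\ s \in square_group, r \in R & x = s * r]) ->
  \dim (W 0) <= \dim (W d) + size R * m.
Proof.
move=> Rrep.
have [||I IP] := @vspace_of_closed _ _ (fun c => forall y, y \in square_group ->
  translate y c = c).
- by move=> y _; rewrite linear0.
- by move=> a u v Pu Pv y yH; rewrite linearP /= Pu ?Pv.
have sub : (W 0 <= I + W d)%VS.
  elim: d => [|d IH]; first exact: addvSr.
  apply: subv_trans IH _; rewrite subv_add addvSl /=.
  apply/subvP => c cW; rewrite -[c](subrK (average c)) addrC.
  by apply: memv_add; [apply/IP => y; apply: translate_average|apply: sub_average].
apply: leq_trans (dimvS sub) _; apply: leq_trans (dimv_add_leqif I (W d)).1 _.
rewrite addnC leq_add2l.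
pose g c : {ffun 'I_(size R) * 'I_m -> rat^o} := [ffun p : 'I_(size R) * 'I_m =>
  c (nth 1 R p.1, p.2)].
have := @leq_dim_relative _ _ _ g I 0%VS fullv 0%VS.
rewrite !dimv0 !subn0 dim_ffun card_prod !card_ord; apply.
- by move=> a u v; apply/ffunP => p; rewrite !ffunE.
- exact: sub0v.
- exact: sub0v.
- by move=> v _; exact: memvf.
move=> c /IP cI; rewrite !memv0 => /eqP g0; apply/eqP/ffunP => -[x a].
have [s [r [sH rR ->]]] := Rrep x.
have iR : index r R < size R by rewrite index_mem.
have /ffunP/(_ (Ordinal iR, a)) := g0; rewrite !ffunE /= nth_index // => c0.
by have /ffunP/(_ (r, a)) := cI s sH; rewrite ffunE /= c0 => ->.
Qed.

End Flag.
End Translation.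

Lemma square_group_odd (H : finGroupType) (x : H) : odd #|H| -> x \in square_group H.
Proof.
move=> oddH; set k := (#|H|.+1)./2; have <- : x ^+ k * x ^+ k = x.
  rewrite -expgD addnn halfK /= oddH /= subn0 expgS.
  by rewrite -cardsT expg_cardG ?inE // mulg1.
by apply: mem_gen; apply/imsetP; exists (x ^+ k).
Qed.

(** Modulo squares the group is an elementary abelian 2-group on two generators. *)
Lemma square_group_cosets2 (H : finGroupType) (h : 'I_2 -> H) :
  generated h ->
  forall x, exists s r, [/\ s \in square_group H,
    r \in [:: 1; h ord0; h ord_max; h ord0 * h ord_max] & x = s * r].
Proof.
move=> gen x; set K := square_group H.
have nK y : y \in 'N(K).
  suff /fintype.subsetP : [set: H] \subset 'N(K) by apply; rewrite inE.
  apply: norms_gen; apply/fintype.subsetP => z _; rewrite inE;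
    apply/fintype.subsetP => t.
  case/imsetP=> u /imsetP[v _ ->] ->; apply/imsetP; exists (v ^ z) => //.
  by rewrite conjMg.
pose kap := coset K.
have kapM u v : kap (u * v) = kap u * kap v by rewrite /kap morphM.
have kap1 : kap 1 = 1 by rewrite /kap morph1.
have kap2 u : kap u * kap u = 1.
  rewrite -kapM; apply: coset_id; apply: mem_gen; apply/imsetP; by exists u.
have kapV u : (kap u)^-1 = kap u by apply: (mulgI (kap u)); rewrite mulgV kap2.
have kapC u v : kap u * kap v = kap v * kap u.
  by rewrite -kapM -[LHS]kapV kapM invMg !kapV.
have [w <-] := gen x.
have [r rR kr] : exists2 r, r \in [:: 1; h ord0; h ord_max; h ord0 * h ord_max] &
    kap (word_eval h w) = kap r.
  elim: w => [|[i e] w [r rR kr]] /=; first by exists 1; rewrite ?inE ?eqxx.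
  rewrite kapM kr.
  have -> : kap (letter_eval h (i, e)) = kap (h i).
    by case: e; rewrite /letter_eval //= /kap morphV // kapV.
  have : i = ord0 \/ i = ord_max.
    by case: i => [[|[|i]] Hi] //; [left|right]; apply: val_inj.
  move: rR; rewrite !inE => /or4P[] /eqP -> [] ->; rewrite ?kap1 ?kapM ?kap2 ?mulg1.
  - by exists (h ord0); rewrite ?inE ?eqxx ?orbT // mul1g.
  - by exists (h ord_max); rewrite ?inE ?eqxx ?orbT // mul1g.
  - by exists 1; rewrite ?inE ?eqxx ?orbT.
  - by exists (h ord0 * h ord_max); rewrite ?inE ?eqxx ?orbT // kapM.
  - by exists (h ord0 * h ord_max); rewrite ?inE ?eqxx ?orbT // kapM kapC.
  - by exists 1; rewrite ?inE ?eqxx ?orbT.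
  - by exists (h ord_max); rewrite ?inE ?eqxx ?orbT // mulgA kap2 mul1g.
  - by exists (h ord0); rewrite ?inE ?eqxx ?orbT // kapC mulgA kap2 mul1g.
move/rcoset_kercosetP: kr => /(_ (nK _) (nK _)); rewrite mem_rcoset => sK.
by exists (word_eval h w * r^-1), r; rewrite mulgVK.
Qed.

(** * Extensions by periods *)

Section Wreath.
Variables (P : finGroupType) (T : finType) (V : finZmodType).

Definition wreath : Type := ({ffun P * T -> V} * P)%type.

HB.instance Definition _ := Finite.on wreath.

Definition wreath_one : wreath := ([ffun=> 0%R], 1).
(** The function records integrals from every base point. The second path starts where the first one
    ends, whence the shift by [a.2]. *)
Definition wreath_mul (a b : wreath) : wreath :=
  ([ffun z => (a.1 z + b.1 (z.1 * a.2, z.2)%g)%R], a.2 * b.2).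
Definition wreath_inv (a : wreath) : wreath :=
  ([ffun z => (- a.1 (z.1 * a.2^-1, z.2)%g)%R], a.2^-1).

Fact wreath_mulA : associative wreath_mul.
Proof.
move=> a b c; congr pair; last exact: mulgA.
by apply/ffunP => z; rewrite !ffunE /= addrA mulgA.
Qed.

Fact wreath_mul1 : left_id wreath_one wreath_mul.
Proof.
move=> [v g]; congr pair; last exact: mul1g.
by apply/ffunP => -[z t]; rewrite !ffunE /= add0r mulg1.
Qed.

Fact wreath_mulV : left_inverse wreath_one wreath_inv wreath_mul.
Proof.
move=> [v g]; congr pair; last exact: mulVg.
by apply/ffunP => -[z t]; rewrite !ffunE /= addNr.
Qed.

HB.instance Definition _ :=
  Finite_isGroup.Build wreath wreath_mulA wreath_mul1 wreath_mulV.

End Wreath.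

Lemma Zp_int_eq0 q (z : int) : 1 < q -> ((z%:~R == 0 :> 'Z_q) = (q %| z)%Z)%R.
Proof.
move=> q1.
have nat_case (k : nat) : ((k%:R == 0 :> 'Z_q) = (q %| k)%N)%R.
  by rewrite Zp_nat -val_eqE /= Zp_cast.
case: z => k; first by rewrite -pmulrn nat_case.
by rewrite NegzE mulrNz oppr_eq0 -pmulrn nat_case dvdzE abszN.
Qed.

Section Restriction.
Variables (n : nat) (P : finGroupType) (f : 'I_n -> P).

Definition word_image : {set P} := [set x | `[< exists w, word_eval f w = x >]].

Fact word_image_group : group_set word_image.
Proof.
apply/group_setP; split; first by rewrite finset.in_set; apply/asboolP; exists [::].
move=> x y; rewrite !finset.in_set => /asboolP[u <-] /asboolP[v <-].
by apply/asboolP; exists (u ++ v); rewrite word_eval_cat.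
Qed.

(** Passing to the subgroup generated by the marking keeps the kernel, and its order still is a
    power of [p] if that of [P] is. *)
Lemma generated_quotient : exists (G : finGroupType) (g : 'I_n -> G),
  [/\ generated g, #|G| %| #|P|
    & forall w, (word_eval g w == 1) = (word_eval f w == 1)].
Proof.
pose I := Group word_image_group.
have fI a : f a \in I.
  by rewrite finset.in_set; apply/asboolP; exists [:: (a, false)]; rewrite /= mulg1.
pose g a : subg_of I := Subg (fI a).
have gE w : sgval (word_eval g w) = word_eval f w.
  elim: w => [|[a b] w IH] //=.
  by rewrite -IH; case: b.
exists (subg_of I), g; split.
- move=> u; have := subgP u; rewrite finset.in_set => /asboolP[w wu].
  by exists w; apply: val_inj; rewrite /= gE.
- have -> : #|subg_of I| = #|I| by rewrite card_sub; apply: eq_card => x;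
  rewrite !inE.
  by rewrite -cardsT cardSg // finset.subsetT.
- by move=> w; rewrite -gE -val_eqE.
Qed.

End Restriction.

Section Extension.
Variables (n : nat) (P : finGroupType) (f : 'I_n -> P) (T : finType).
Variables (c : T -> P -> 'I_n -> int).

(* The kernel is that of the map to the wreath product of ['Z_(p ^ e)] by [P]
   sending a word to its endpoint and its integrals from all base points. *)
Lemma period_extension (p e : nat) : prime p -> 0 < e -> p.-nat #|P| ->
  exists (G : finGroupType) (g : 'I_n -> G),
  [/\ generated g, p.-nat #|G| &
    forall w, word_eval g w = 1 <-> word_eval f w = 1 /\
      forall t x, ((p ^ e)%N %| integral f (c t) x w)%Z].
Proof.
move=> pp e0 pP; set q := (p ^ e)%N.
have q1 : 1 < q by rewrite -{1}(exp1n e) ltn_exp2r // prime_gt1.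
pose F a : wreath P T 'Z_q := ([ffun z => ((c z.2 z.1 a)%:~R)%R], f a).
have FE w : word_eval F w =
    ([ffun z => ((integral f (c z.2) z.1 w)%:~R)%R], word_eval f w).
  elim: w => [|[a b] w IH] /=.
    by congr pair; apply/ffunP => z; rewrite !ffunE.
  rewrite IH; case: b; congr pair; apply/ffunP => -[x t];
    by rewrite !ffunE /= rmorphD /= ?rmorphN.
have [G [g [gen cardG gE]]] := generated_quotient F.
exists G, g; split => //.
  apply: pnat_dvd cardG _; rewrite card_prod card_ffun pnatM pP andbT.
  by rewrite pnatX card_ord Zp_cast // pnatX pnat_id.
move=> w; split.
  move/eqP; rewrite gE FE => /eqP[/ffunP E0 ->]; split => // t x.
  by have := E0 (x, t); rewrite !ffunE /= => /eqP; rewrite Zp_int_eq0.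
move=> [w1 dvd]; apply/eqP; rewrite gE FE w1; apply/eqP; congr pair.
by apply/ffunP => -[x t]; rewrite !ffunE /=; apply/eqP; rewrite Zp_int_eq0.
Qed.

End Extension.

Lemma integral_steps0 (A : choiceType) (G : groupType) (f : A -> G) (V : zmodType)
    (c : G -> A -> V) x w :
  (forall u z v, w = u ++ z :: v -> step f c (x * word_eval f u) z = 0%R) ->
  integral f c x w = 0%R.
Proof.
elim: w x => [|z w IH] x h //=.
have := h [::] z w erefl; rewrite /= mulg1 => ->; rewrite add0r.
by apply: IH => u z' v wE; have := h (z :: u) z' v; rewrite wE /= mulgA; apply.
Qed.

(** * Raising the girth by a p-extension *)

Section GirthStep.
Variables (n : nat) (P : finGroupType) (f : 'I_n -> P).

Definition edge_cochain (a : 'I_n) (x : P) (b : 'I_n) : int := ((x == 1%g) && (b ==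
  a))%:R%R.

Lemma step_edge_cochain a x (z : letter 'I_n) :
  step f (edge_cochain a) x z <> 0%R ->
  z = (a, false) /\ x = 1 \/ z = (a, true) /\ x = f a.
Proof.
case: z => b [] /=; rewrite /step /edge_cochain /=.
  case: (b =P a) => [->|]; last by rewrite andbF oppr0.
  rewrite andbT; case: eqP => [e _|]; last by rewrite oppr0.
  by right; split => //; apply: (mulIg (f a)^-1); rewrite e mulgV.
case: (b =P a) => [->|]; last by rewrite andbF.
by rewrite andbT; case: eqP => [-> _|//]; left.
Qed.

(* A shortest closed path is embedded, so it crosses its first edge only once and
   cannot vanish in the mod-[p] homology. *)
Lemma period_shortest_loop a b l w :
  girth_gt f l -> size ((a, b) :: w) <= l.+1 -> reduced ((a, b) :: w) ->
  word_eval f ((a, b) :: w) = 1 ->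
  integral f (edge_cochain a) (if b then f a else 1) ((a, b) :: w) = ((-1) ^+ b)%R.
Proof.
move=> gir sw rw ew; pose z := (a, b); pose x := if b then f a else 1.
(* If the first edge is crossed again forwards, the path has returned to its start; if backwards, it
   returns there by this crossing. *)
have stepE u z' : step f (edge_cochain a) (x * word_eval f (z :: u)) z' <> 0%R ->
    word_eval f (z :: u) = 1 \/
    z' = letter_inv z /\ word_eval f (z :: rcons u z') = 1.
  move=> /step_edge_cochain; rewrite /x /z; case: b {ew rw sw z x} => /=.
    rewrite /letter_eval /= => -[] [-> e]; last by left; apply: (mulgI (f a));
      rewrite mulg1; exact: e.
    by right; split => //; move: e; rewrite word_eval_rcons mulKVg => ->;
      rewrite mul1g /letter_eval /= mulVg.
  rewrite mul1g => -[] [-> e]; first by left.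
  by right; split => //; rewrite word_eval_rcons mulgA e /letter_eval /= mulgV.
rewrite -/x -/z /= integral_steps0 ?addr0.
  by rewrite /step /x /z /edge_cochain /=; case: (b); rewrite /= ?mulgV !eqxx.
move=> u z' v wE; apply: contrapT.
have := @stepE u z'; rewrite [word_eval _ _ in X in X -> _]/= mulgA => h /h{h}.
rewrite -/z wE -cat_cons in rw sw ew.
have ru : reduced (z :: u) by have [] := cat_sorted2 rw.
case=> [e1|[z'E e1]].
  suff su : size (z :: u) <= l by have := gir (z :: u) ru su e1.
  by move: sw; rewrite size_cat addnS ltnS; apply: leq_trans; apply: leq_addr.
(* The closed subword found is too short for the girth, unless the backward crossing is the last
   letter. Then the word is [u] conjugated by [z], so [u] is closed, hence empty, and the word is
   not reduced. *)
case: v => [|z2 v] in wE rw sw ew.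
  have eu : word_eval f u = 1.
    move: e1; rewrite z'E /= word_eval_rcons letter_eval_inv mulgA =>
      /(canRL (mulgVK _)).
    by rewrite mul1g => /(canRL (mulKg _)); rewrite mulVg.
  have u0 : u = [::].
    apply: gir eu; first by apply: path_sorted ru.
    by move: sw; rewrite size_cat addn1 ltnS; apply: leq_trans; apply: leqnSn.
  by move: rw; rewrite u0 z'E /reduced /= eqxx.
have rz : reduced (z :: rcons u z').
  by move: rw; rewrite -cat_rcons rcons_cons => /cat_sorted2[].
suff sz : size (z :: rcons u z') <= l by have := gir _ rz sz e1.
by move: sw; rewrite size_cat /= size_rcons !addnS ltnS; apply: leq_trans;
  rewrite ltnS leq_addr.
Qed.

(** The indicators of edges open up the loops of length [l.+1]. The constant cochains are added so
    that exponent sums of closed words are divisible by [p]; for [p = 2] this makes the sign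
    characters trivial on closed words. *)
Lemma girth_extension (p l : nat) : prime p -> p.-nat #|P| -> girth_gt f l ->
  exists (G : finGroupType) (g : 'I_n -> G),
  [/\ generated g, p.-nat #|G|, girth_gt g l.+1 &
    forall w, word_eval g w = 1 -> word_eval f w = 1 /\
      forall a, (p %| integral f (fun _ b => (b == a)%:R%R : int) 1 w)%Z].
Proof.
move=> pp pP gir.
pose c (t : 'I_n * bool) : P -> 'I_n -> int :=
  if t.2 then edge_cochain t.1 else fun _ b => (b == t.1)%:R%R.
have [G [g [gen pG gE]]] := period_extension f c pp (isT : 0 < 1) pP.
exists G, g; split => //.
  move=> w rw sw /gE[ew]; rewrite expn1 => dvd.
  case: w => [//|[a b] w] in rw sw ew dvd *.
  have := dvd (a, true) (if b then f a else 1).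
  rewrite (period_shortest_loop gir) // dvdzE abszX abszN1 exp1n dvdn1 => /eqP p1.
  by move: p1 pp => /= ->.
move=> w /gE[ew dvd]; split => // a.
by have := dvd (a, false) 1; rewrite expn1.
Qed.

End GirthStep.

(** * Classes vanishing on short loops *)

Section Permute.
Variables (n : nat) (G : finGroupType) (g : 'I_n -> G) (c : cochain n G).
Variables (I : eqType) (t : I -> seq (letter 'I_n)).
Local Notation F s := (flatten (map t s)).
Local Notation J := (line_integral g c).
Hypothesis t_comm : forall i j, word_eval g (t i ++ t j) = word_eval g (t j ++ t i).
Hypothesis Jt_comm : forall x i j, J x (t i ++ t j) = J x (t j ++ t i).

Lemma line_integral_perm x s1 s2 : perm_eq s1 s2 -> J x (F s1) = J x (F s2).
Proof.
have mid i s s' y : J y (F (s ++ i :: s')) = J y (F (i :: s ++ s')).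
  elim: s y => [//|j s IH] y.
  rewrite /= line_integral_cat IH /= -line_integral_cat !catA.
  by rewrite line_integral_cat Jt_comm t_comm -line_integral_cat.
elim: s1 s2 x => [|i s1 IH] s2 x.
  by rewrite perm_sym => /perm_nilP ->.
move=> p12; have is2 : i \in s2 by rewrite -(perm_mem p12) inE eqxx.
case: (splitPr is2) p12 => a b p12; rewrite mid /= !line_integral_cat;
  congr (_ + _)%R.
by apply: IH; rewrite -(perm_cons i); apply: perm_trans p12 _;
  exact: (permEl (perm_catCA a [:: i] b)).
Qed.

Lemma word_eval_nseq i k : word_eval g (F (nseq k i)) = word_eval g (t i) ^+ k.
Proof.
by elim: k => [|k IH]; rewrite ?expg0 //= word_eval_cat IH expgS.
Qed.

(** A block [t i] may fail to be closed, but its [Q]-th power is closed. Repeating the word [Q]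
    times and sorting the blocks splits it into such powers, all based at [x]. *)
Lemma line_integral_count x s Q : word_eval g (F s) = 1 ->
  (forall i, word_eval g (t i) ^+ Q = 1) ->
  (Q%:R * J x (F s) = \sum_(i <- s) J x (F (nseq Q i)))%R.
Proof.
move=> s1 tQ.
have -> : (Q%:R * J x (F s) = J x (F (flatten (nseq Q s))))%R.
  elim: Q {tQ} => [|Q IH]; first by rewrite mul0r.
  rewrite /= map_cat flatten_cat line_integral_cat s1 mulg1 -IH.
  by rewrite -addn1 natrD mulrDl mul1r addrC.
rewrite (@line_integral_perm _ _ (flatten [seq nseq Q i | i <- s])).
  elim: s {s1} => [|i s IH]; first by rewrite big_nil.
  rewrite /= map_cat flatten_cat line_integral_cat word_eval_nseq tQ mulg1.
  by rewrite big_cons IH.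
apply/seq.permP => a; rewrite !count_flatten map_nseq sumn_nseq -map_comp.
elim: s {s1} => [|i s IH] //=.
by rewrite count_nseq mulnDl IH.
Qed.

End Permute.

Section Killing.
Variables (n : nat) (P : finGroupType) (f : 'I_n -> P).
Hypothesis gen_f : generated f.

Let I : finType := (P * ('I_n * bool))%type.

(** Schreier rewriting, with one generator for each edge crossed. The decomposition is computed in
    [P] and holds up to free cancellation, so it serves every marked group [G] at once. *)
Lemma schreier_words : exists (t : I ->
  seq (letter 'I_n)) (dec : seq (letter 'I_n) -> seq I),
  (forall i, word_eval f (t i) = 1) /\
  forall w, word_eval f w = 1 ->
  forall (G : groupType) (g : 'I_n -> G),
    word_eval g (flatten (map t (dec w))) = word_eval g w /\
  forall (V : zmodType) (c : G -> 'I_n -> V) x,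
    integral g c x (flatten (map t (dec w))) = integral g c x w.
Proof.
have [wd0 wd0E] := choice gen_f.
(* The empty word at 1 leaves no boundary words when the product of the [t i] telescopes. *)
pose wd s := if s == 1 then [::] else wd0 s.
have wdE s : word_eval f (wd s) = s by rewrite /wd; case: eqP => [->|].
pose t (i : I) := wd i.1 ++ i.2 :: word_inv (wd (i.1 * letter_eval f i.2)).
pose dec := fix dec (s : P) (w : seq (letter 'I_n)) : seq I :=
  if w is l :: w' then (s, l) :: dec (s * letter_eval f l) w' else [::].
exists t, (dec 1); split.
  move=> [s l]; rewrite /t word_eval_cat /= word_eval_inv !wdE invgM mulKVg mulgV //.
move=> w w1 G g.
have H s u : word_eval g (flatten (map t (dec s u)) ++ wd (s * word_eval f u)) =
    word_eval g (wd s ++ u) /\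
    forall (V : zmodType) (c : G -> 'I_n -> V) x,
    integral g c x (flatten (map t (dec s u)) ++ wd (s * word_eval f u)) =
    integral g c x (wd s ++ u).
  elim: u s => [|l u IH] s; first by rewrite /= mulg1 cats0.
  rewrite /= mulgA; have [IH1 IH2] := IH (s * letter_eval f l).
  split => [|V c x]; rewrite -catA.
    rewrite word_eval_cat IH1 /t !word_eval_cat /= word_eval_inv -!mulgA.
    by rewrite mulKg.
  pose v := wd (s * letter_eval f l);
    rewrite integral_cat IH2 -/v -integral_cat /t /= -/v.
  have cancel y : integral g c y (word_inv v ++ v) = 0%R.
    by rewrite integral_cat -{3}[v]word_invK integral_word_inv subrr.
  have -> : (wd s ++ l :: word_inv v) ++ v ++ u =
      wd s ++ [:: l] ++ (word_inv v ++ v) ++ u by rewrite /= -!catA.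
  rewrite [LHS]integral_cat [RHS]integral_cat; congr (_ + _)%R.
  rewrite integral_cat [RHS]/= [X in (X + _)%R]/= addr0; congr (_ + _)%R.
  rewrite integral_cat cancel add0r word_eval_cat word_eval_inv mulVg mulg1.
  by rewrite /= mulg1.
have [] := H 1 w; rewrite w1 mulg1 /wd eqxx cats0 /= => H1 H2.
by split.
Qed.

Lemma cochain_loop_comm (G : finGroupType) (g : 'I_n -> G) r c u v x :
  c \in cocycles g r -> (size u + size v).*2 <= r ->
  word_eval g (u ++ v) = word_eval g (v ++ u) ->
  line_integral g c x (u ++ v) = line_integral g c x (v ++ u).
Proof.
move=> /cocyclesP cz suv e; apply/eqP; rewrite -subr_eq0.
have := cz x ((u ++ v) ++ word_inv (v ++ u)).
rewrite line_integral_cat e {2}/line_integral integral_word_inv => -> //.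
  by rewrite size_cat size_word_inv !size_cat [X in _ + X]addnC addnn.
by rewrite word_eval_cat word_eval_inv e mulgV.
Qed.

(* A class vanishing on short loops factors through the finite-dimensional space
   of exponent vectors of the Schreier words [t], so it is enough to test it on
   finitely many words of [Z], chosen independently of [G]. *)
Lemma finite_vanishing_test (Z : seq (letter 'I_n) -> Prop) :
  (forall z, Z z -> word_eval f z = 1) ->
  exists rho, forall (G : finGroupType) (g : 'I_n -> G) r (c : cochain n G),
    rho <= r ->
    (forall u v, word_eval f u = 1 -> word_eval f v = 1 ->
      word_eval g (u ++ v) = word_eval g (v ++ u)) ->
    (forall z, Z z -> word_eval g z = 1) -> c \in cocycles g r ->
    forall z x, Z z -> line_integral g c x z = 0%R.
Proof.
move=> Zf; have [t [dec [tf decE]]] := schreier_words.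
pose vec (s : seq I) : {ffun I -> rat^o} := [ffun i => ((count_mem i s)%:R)%R].
have [s [sZ Zs]] := finite_spanning (fun v => exists z, Z z /\ v = vec (dec z)).
have [rho1 rho1P] : exists rho1, forall v, v \in s ->
    exists z, [/\ Z z, v = vec (dec z) & size z <= rho1].
  elim: s sZ {Zs} => [|v s IH] sZ; first by exists 0.
  have [|k kP] := IH; first by move=> u us; apply: sZ; rewrite inE us orbT.
  have [z [Zz vz]] := sZ v (mem_head _ _); exists (maxn k (size z)) => u.
  rewrite inE => /orP[/eqP ->|/kP[z' [Zz' uz' sz']]].
    by exists z; split; rewrite // leq_maxr.
  by exists z'; split; rewrite // leq_max sz'.
pose M := \max_(i : I) size (t i).
have tM i : size (t i) <= M by exact: leq_bigmax.
exists (maxn rho1 (M + M).*2) => G g r c; rewrite geq_max =>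
  /andP[r1 rM] comm Zg cz z x Zz.
set J := line_integral g c.
have tcomm i j : word_eval g (t i ++ t j) = word_eval g (t j ++ t i) by apply: comm.
have Jcomm y i j : J y (t i ++ t j) = J y (t j ++ t i).
  apply: (cochain_loop_comm _ cz) => //.
  by apply: leq_trans rM; rewrite leq_double leq_add.
have tQ i : word_eval g (t i) ^+ #|G| = 1 by rewrite -cardsT expg_cardG ?inE.
(* [Phi] is linear in the exponent vector, and on words of [Z] it is the period multiplied by the
   order of [G]. *)
pose E i := J x (flatten (map t (nseq #|G| i))).
pose Phi (v : {ffun I -> rat^o}) : rat := (\sum_i v i * E i)%R.
have Q0 : (#|G|%:R != 0 :> rat)%R.
  by rewrite pnatr_eq0 -lt0n; apply/card_gt0P; exists 1.
have JPhi z' : Z z' -> (#|G|%:R * J x z' = Phi (vec (dec z')))%R.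
  move=> Zz'; have [ev iv] := decE z' (Zf _ Zz') G g.
  rewrite {1}/J {1}/line_integral -iv -/(line_integral g c _ _).
  rewrite (line_integral_count _ _ x _ tQ) //; last by rewrite ev Zg.
  rewrite -/J /Phi; elim: (dec z') => [|i w IH].
    by rewrite big_nil big1 // => i _; rewrite ffunE mul0r.
  rewrite big_cons IH (bigD1 i) //= [RHS](bigD1 i) //= addrA; congr (_ + _)%R.
    by rewrite !ffunE /= eqxx natrD mulrDl mul1r.
  by apply: eq_bigr => j ji; rewrite !ffunE /= eq_sym (negbTE ji).
have Phi0 v : v \in << s >>%VS -> Phi v = 0%R.
  apply: (span_ind (P := fun v => Phi v = 0%R)).
  - by rewrite /Phi big1 // => i _; rewrite ffunE mul0r.
  - move=> a u w; rewrite /Phi => u0 w0.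
    transitivity (a * (\sum_i u i * E i) + \sum_i w i * E i)%R.
      rewrite mulr_sumr -big_split /=; apply: eq_bigr => i _.
      by rewrite !ffunE mulrDl mulrA.
    by rewrite u0 w0 mulr0 addr0.
  move=> u /rho1P[z' [Zz' -> sz']]; rewrite -JPhi //.
  have -> : J x z' = 0%R; last exact: mulr0.
  by move/cocyclesP: cz; apply; [apply: leq_trans sz' r1|apply: Zg].
have : Phi (vec (dec z)) = 0%R by apply: Phi0; apply: Zs; exists z.
by rewrite -JPhi // => /eqP; rewrite mulf_eq0 (negbTE Q0) => /eqP.
Qed.

End Killing.

(** * Directions dying at separated scales *)

Section WordPower.
Variable A : choiceType.
Implicit Types w : seq (letter A).

Definition word_pow w (z : int) : seq (letter A) :=
  match z with
  | Posz k => flatten (nseq k w)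
  | Negz k => flatten (nseq k.+1 (word_inv w))
  end.

Lemma word_eval_pow (G : groupType) (g : A -> G) w z :
  word_eval g w = 1 -> word_eval g (word_pow w z) = 1.
Proof.
move=> w1; have nat_pow u k : word_eval g u = 1 ->
  word_eval g (flatten (nseq k u)) = 1.
  by move=> u1; elim: k => [//|k IH]; rewrite /= word_eval_cat u1 IH mulg1.
case: z => k; first exact: nat_pow.
by apply: nat_pow; rewrite word_eval_inv w1 invg1.
Qed.

Lemma additive_word_pow (G : groupType) (g : A ->
  G) (V : zmodType) (F : seq (letter A) -> V) w z :
  F [::] = 0%R -> (forall u v, word_eval g u = 1 -> F (u ++ v) = (F u + F v)%R) ->
  (forall u, word_eval g u = 1 -> F (word_inv u) = (- F u)%R) ->
  word_eval g w = 1 -> F (word_pow w z) = (F w *~ z)%R.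
Proof.
move=> F0 Fcat Finv w1.
have nat_pow u k : word_eval g u = 1 -> F (flatten (nseq k u)) = (F u *+ k)%R.
  by move=> u1; elim: k => [//|k IH]; rewrite /= Fcat // IH mulrS.
case: z => k; first exact: nat_pow.
rewrite -[LHS]/(F (flatten (nseq k.+1 (word_inv w)))) nat_pow; last first.
  by rewrite word_eval_inv w1 invg1.
by rewrite Finv // mulNrn.
Qed.

End WordPower.

Section Gap.
Variables (n : nat) (P : finGroupType) (f : 'I_n -> P) (p d e0 B : nat).
Variables (lam chi : nat -> seq (letter 'I_n) -> int).
Variable (y : nat -> nat -> seq (letter 'I_n)).
Hypotheses (gen_f : generated f) (p_prime : prime p).
Hypothesis lam_nil : forall k, lam k [::] = 0%R.
Hypothesis lam_cat : forall k u v, lam k (u ++ v) = (lam k u + chi k u * lam k v)%R.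
Hypothesis chi_closed : forall k w, k < d -> word_eval f w = 1 -> chi k w = 1%R.
Hypothesis lam_inv : forall k w, chi k w = 1%R -> lam k (word_inv w) = (- lam k w)%R.
Hypothesis lam_bound : forall k w, `|lam k w|%N <= size w.
Hypothesis lam_cochain : forall (G : finGroupType) (g : 'I_n -> G), generated g ->
  (forall w, word_eval g w = 1 -> word_eval f w = 1) -> forall k, k < d ->
  exists (c : G -> 'I_n -> int) (s : G -> int), s 1 = 1%R /\
    forall x w, integral g c x w = (s x * lam k w)%R.
Hypothesis y_eval : forall k e, k < d -> e0 <= e -> word_eval f (y k (p ^ e)%N) = 1.
Hypothesis y_size : forall k q, size (y k q) <= (q + q).+2.
Hypothesis y_diag : forall k e, k < d -> e0 <= e -> lam k (y k (p ^ e)%N) <> 0%R.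
Hypothesis y_above : forall j k e, k < j -> j < d -> e0 <= e ->
  lam j (y k (p ^ e)%N) = 0%R.
Hypothesis y_dvd : forall j k e, j <= k -> k < d -> e0 <= e ->
  ((p ^ e)%N %| lam j (y k (p ^ e)%N))%Z.

(** The increment bounds the length of the [k]-th dual word at [p ^ level s0 k], which is therefore
    filled in at the next scale. The exponent makes this power of [p] exceed [B * scale s0 k]. *)
Fixpoint scale (s0 k : nat) : nat :=
  if k is k'.+1 then scale s0 k' + (2 * p ^ (e0 + B * scale s0 k'))%N.+2 else s0.

Definition level s0 k := e0 + B * scale s0 k.

Lemma scale_le s0 j k : j <= k -> scale s0 j <= scale s0 k.
Proof.
by move/subnK <-; elim: (k - j) => [//|i IH]; rewrite addSn;
  apply: leq_trans IH (leq_addr _ _).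
Qed.

Lemma level_le s0 j k : j <= k -> level s0 j <= level s0 k.
Proof. by move=> jk; rewrite /level leq_add2l leq_mul2l scale_le ?orbT. Qed.

(* The [k]-th direction only dies at scale [p ^ level k], which is chosen much
   larger than the scale at which the preceding directions have died. *)
Lemma betti_gaps : exists s0, B <= s0 /\
  forall (G : finGroupType) (g : 'I_n -> G), generated g ->
  (forall w, word_eval g w = 1 <-> word_eval f w = 1 /\
     forall k, k < d -> ((p ^ level s0 k)%N %| lam k w)%Z) ->
  forall k, k <= d ->
    betti g (scale s0 k) <= d - k /\ d - k <= betti g (B * scale s0 k).
Proof.
pose Z w := word_eval f w = 1 /\ forall k, k < d -> lam k w = 0%R.
have [|rho rhoP] := finite_vanishing_test gen_f (Z := Z); first by move=> z [].
(* [rho] depends only on [f] and the [lam k], so the exponents, which are computed from [s0], can be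
   fixed after it. *)
exists (maxn rho B); rewrite leq_maxr; split => // G g gen_g kerG k kd.
set s0 := maxn rho B in kerG *; set s := scale s0; pose q j := (p ^ level s0 j)%N.
have q_large j : B * s j < q j.
  apply: leq_ltn_trans (ltn_expl _ (prime_gt1 p_prime)).
  by rewrite /level -/s leq_addl.
have e0_level j : e0 <= level s0 j by rewrite /level leq_addr.
pose yq j := y j (q j).
have ygP j : j < d -> word_eval g (yq j) = 1.
  move=> jd; apply/kerG; split; first exact: y_eval.
  move=> i id; case: (ltnP j i) => [ji|ij]; first by rewrite y_above // dvdz0.
  apply: (@dvdz_trans (q j)); last exact: y_dvd.
  by rewrite dvdzE /=; apply: dvdn_exp2l; apply: level_le.
(* The kernel of [G -> P] is abelian, because each [lam j] is additive on words closed in [P]. *)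
have comm u v : word_eval f u = 1 -> word_eval f v = 1 ->
    word_eval g (u ++ v) = word_eval g (v ++ u).
  move=> u1 v1; have : word_eval g ((u ++ v) ++ word_inv (v ++ u)) = 1.
    apply/kerG; split.
      by rewrite !word_eval_cat word_eval_inv word_eval_cat u1 v1 !mul1g invg1.
    move=> j jd; have chi1 w : word_eval f w = 1 ->
      chi j w = 1%R by exact: chi_closed.
    rewrite lam_cat lam_inv; last by rewrite chi1 // word_eval_cat u1 v1 mulg1.
    rewrite !lam_cat !chi1 ?word_eval_cat ?u1 ?v1 ?mulg1 // !mul1r.
    by rewrite [X in (_ - X)%R]addrC subrr dvdz0.
  rewrite word_eval_cat word_eval_inv => /(canRL (mulgVK _)); rewrite mul1g //.
have y_scale j : j < k -> size (yq j) <= s k.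
  move=> jk; apply: leq_trans (scale_le s0 jk); rewrite /=.
  by apply: leq_trans (y_size _ _) _;
    rewrite -/(level s0 j) -/(q j) addnn -mul2n leq_addl.
split.
  (* Upper bound: a class is determined by its periods on the dual words that are not yet filled
     in. *)
  have := @leq_dim_relative _ _ _
    (fun c : cochain n G => [ffun i : 'I_(d - k) =>
      line_integral g c 1 (yq (k + i)) : rat^o])
    (cocycles g (s k)) (coboundaries g) fullv 0%VS.
  rewrite dimv0 subn0 dim_ffun card_ord; apply.
  - by move=> a u v; apply/ffunP => i; rewrite !ffunE (line_integral_linear g).
  - exact: coboundaries_sub.
  - exact: sub0v.
  - by move=> c _; exact: memvf.
  move=> c cz; rewrite memv0 => /eqP/ffunP yc0.
  have Jy j : j < d -> line_integral g c 1 (yq j) = 0%R.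
    move=> jd; case: (ltnP j k) => [jk|kj].
      by move/cocyclesP: cz; apply; [apply: y_scale|apply: ygP].
    have jk : j - k < d - k by rewrite ltn_sub2r //; apply: leq_ltn_trans kj jd.
    by have := yc0 (Ordinal jk); rewrite !ffunE /= subnKC.
  apply: exact_of_periods => // w w1.
  (* Words are cleared of their components [lam i] from the top index down; once all have gone, the
     finite test applies. *)
  suff H j : j <= d -> forall u, word_eval g u = 1 ->
      (forall i, j <= i -> i < d -> lam i u = 0%R) -> line_integral g c 1 u = 0%R.
    by apply: (H d) => // i di id; move: (leq_ltn_trans di id); rewrite ltnn.
  elim: j => [_ u /kerG[u1 _] lu|j IH jd u u1 lu].
    apply: (rhoP G g (s k) c _ comm _ cz u 1).
    - by apply: leq_trans (scale_le s0 (leq0n k)); rewrite leq_maxl.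
    - by move=> z [z1 lz]; apply/kerG; split => // i id; rewrite lz // dvdz0.
    - by split => // i id; apply: lu.
  have fclosed v : word_eval g v = 1 -> word_eval f v = 1 by move=> /kerG[].
  have gclosed := ygP j jd.
  have lampow i v z : i < d -> word_eval g v = 1 ->
    lam i (word_pow v z) = (lam i v *~ z)%R.
    move=> id v1; apply: (additive_word_pow (g := g)) => //.
    - by move=> u' v' /fclosed u'1; rewrite lam_cat chi_closed // mul1r.
    - by move=> u' /fclosed u'1; rewrite lam_inv // chi_closed.
  have Jpow v z : word_eval g v = 1 ->
      line_integral g c 1 (word_pow v z) = (line_integral g c 1 v *~ z)%R.
    move=> v1; apply: (additive_word_pow (g := g)) => //.
    - by move=> u' v' u'1; rewrite line_integral_cat u'1 mulg1.
    - move=> u' u'1; rewrite /line_integral.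
      by rewrite -(integral_word_inv g (fun x a => c (x, a) : rat)) u'1 mulg1.
  set mu := lam j (yq j); set t := lam j u.
  (* This combination cancels [lam j], and [y_above] keeps the components of higher index zero. The
     period of [u] then vanishes because [mu] is nonzero. *)
  have [] : line_integral g c 1 (word_pow u mu ++ word_pow (yq j) (- t)) = 0%R.
    apply: IH; first exact: ltnW.
      by rewrite word_eval_cat !word_eval_pow // mulg1.
    move=> i ji id; rewrite lam_cat chi_closed ?mul1r //; last first.
      by apply: fclosed; apply: word_eval_pow.
    rewrite !lampow // mulrNz.
    case: (ltngtP j i) ji => // [ji _|<- _].
      by rewrite lu // /yq y_above // !mul0rz subrr.
    by rewrite -/t -/mu !mulrzz mulrC subrr.
  rewrite line_integral_cat word_eval_pow // mulg1 !Jpow // Jy // mul0rz addr0 =>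
    /eqP.
  rewrite mulrz_eq0 => /orP[/eqP mu0|/eqP //].
  by case: (@y_diag j (level s0 j) jd (e0_level j)).
have real j : exists C : cochain n G, j < d -> exists sg : G -> int, sg 1 = 1%R /\
    forall x w, line_integral g C x w = ((sg x * lam j w)%:~R)%R.
  case: (ltnP j d) => jd; last by exists 0%R.
  have [|c [sg [sg1 cP]]] := lam_cochain gen_g _ jd; first by move=> w /kerG[].
  exists [ffun z => (c z.1 z.2)%:~R%R : rat^o] => _; exists sg; split => // x w.
  rewrite -cP /line_integral; elim: w x => [|[a b] w IH] x //=.
  rewrite IH rmorphD /= /step /=; congr (_ + _)%R.
  by case: b; rewrite ffunE //= rmorphN.
have [C CP] := choice real.
(* Lower bound: the directions from [k] on give independent classes at radius [B * s k]. *)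
have := @leq_dim_relative _ _ _
    (fun b : {ffun 'I_(d - k) -> rat^o} => \sum_i (b i : rat) *: C (k + i)%N)%R
    fullv 0%VS (cocycles g (B * s k)) (coboundaries g).
rewrite dimv0 subn0 dim_ffun card_ord; apply.
- move=> a u v; rewrite scaler_sumr -big_split /=; apply: eq_bigr => i _.
  by rewrite !ffunE scalerDl scalerA.
- exact: sub0v.
- exact: coboundaries_sub.
- move=> b _; apply: rpred_sum => i _; apply: rpredZ.
  have id : k + i < d by rewrite -ltn_subRL.
  have [sg [_ JC]] := CP _ id.
  apply/cocyclesP => x w sw /kerG[_ /(_ _ id) dvd]; rewrite JC.
  (* On a closed word this short, [lam (k + i)] is divisible by [q (k + i)] and smaller than it in
     absolute value. *)
  suff -> : lam (k + i) w = 0%R by rewrite mulr0.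
  apply/eqP; rewrite -absz_eq0; apply: contraTT dvd; rewrite -lt0n => lam0.
  rewrite dvdzE /= gtnNdvd //; apply: leq_ltn_trans (lam_bound _ _) _.
  apply: leq_ltn_trans sw _; apply: leq_ltn_trans (q_large (k + i)).
  by rewrite leq_mul2l scale_le ?orbT // leq_addr.
move=> b _ /coboundariesP[u uP]; rewrite memv0; apply/eqP/ffunP => i;
  rewrite [RHS]ffunE.
(* Triangularity: on the [i]-th dual word the later directions vanish, and the earlier coefficients
   are already known to be zero. *)
elim/ltn_ind: {i}(nat_of_ord i) {-2}i (erefl (nat_of_ord i)) => N IH i iN.
have id : k + i < d by rewrite -ltn_subRL.
have := line_integral_exact 1 (yq (k + i)) uP.
rewrite ygP // mulg1 subrr.
have -> : (line_integral g (\sum_i b i *: C (k + i)) 1 (yq (k + i)) =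
   \sum_j (b j : rat) * (lam (k + j)%N (yq (k + i)%N))%:~R)%R.
  rewrite line_integral_sum; apply: eq_bigr => j _; congr (_ * _)%R.
  have jd : k + j < d by rewrite -ltn_subRL.
  by have [sg [sg1 ->]] := CP _ jd; rewrite sg1 mul1r.
rewrite (bigD1 i) //= big1 ?addr0; last first.
  move=> j ji; case: (ltngtP j i) => [ltji|ltij|/val_inj eij].
  - by rewrite (IH j) ?mul0r // -iN.
  - by rewrite /yq y_above ?mulr0 // ?ltn_add2l // -ltn_subRL.
  - by rewrite eij eqxx in ji.
move/eqP; rewrite mulf_eq0 => /orP[/eqP //|]; rewrite intr_eq0 => /eqP.
by move=> /y_diag; case.
Qed.

End Gap.

(** * Signed exponent sums and their dual words *)

Section SignedHom.
Variables (n : nat) (l : 'I_n * 'I_n).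
Implicit Types (z : letter 'I_n) (u v w : seq (letter 'I_n)).

Definition sign1 z : int := (if (l.1 != l.2) && (z.1 == l.2) then -1 else 1)%R.
Definition expo1 z : int := (if z.1 == l.1 then if z.2 then -1 else 1 else 0)%R.

Definition sign w : int := (\prod_(z <- w) sign1 z)%R.

(* For [l = (a, b)], the crossed homomorphism [expo] with values in the integers
   twisted by [sign] counts the generator [a]; [sign] is the parity of the number
   of occurrences of [b], or trivial if [a = b]. *)
Fixpoint expo w : int := if w is z :: w' then (expo1 z + sign1 z * expo w')%R else
  0%R.

Lemma sign1_sqr z : (sign1 z * sign1 z = 1)%R.
Proof. by rewrite /sign1; case: ifP. Qed.

Lemma sign1_inv z : sign1 (letter_inv z) = sign1 z.
Proof. by []. Qed.

(** The counted generator never changes the sign: it differs from [l.2], or the twist is trivial. *)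
Lemma sign1_expo1 z : (sign1 z * expo1 z = expo1 z)%R.
Proof.
rewrite /sign1 /expo1; case: (z.1 =P l.1) => [->|_]; last by rewrite mulr0.
by case: (l.1 =P l.2); rewrite /= ?mul1r.
Qed.

Lemma expo1_inv z : expo1 (letter_inv z) = (- expo1 z)%R.
Proof. by case: z => a b; rewrite /expo1 /=; case: ifP => //; case: b. Qed.

Lemma sign_cons z w : sign (z :: w) = (sign1 z * sign w)%R.
Proof. exact: big_cons. Qed.

Lemma sign_seq1 z : sign [:: z] = sign1 z.
Proof. exact: big_seq1. Qed.

Lemma sign_cat u v : sign (u ++ v) = (sign u * sign v)%R.
Proof. exact: big_cat. Qed.

Lemma sign_sqr w : (sign w * sign w = 1)%R.
Proof.
elim: w => [|z w IH]; first by rewrite /sign big_nil.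
by rewrite !sign_cons mulrACA IH sign1_sqr.
Qed.

Lemma sign_inv w : sign (word_inv w) = sign w.
Proof.
elim: w => [//|z w IH]; rewrite word_inv_cons -cats1 sign_cat IH sign_seq1.
by rewrite sign_cons sign1_inv mulrC.
Qed.

Lemma expo_cat u v : expo (u ++ v) = (expo u + sign u * expo v)%R.
Proof.
elim: u => [|z u IH] /=; first by rewrite /sign big_nil add0r mul1r.
by rewrite IH sign_cons mulrDr addrA mulrA.
Qed.

Lemma expo_inv w : expo (word_inv w) = (- (sign w * expo w))%R.
Proof.
elim: w => [|z w IH]; first by rewrite /= mulr0 oppr0.
rewrite word_inv_cons -cats1 expo_cat IH sign_inv sign_cons /= mulr0 addr0 expo1_inv.
have := sign1_sqr z; have := sign1_expo1 z.
move: (sign1 z) (expo1 z) (sign w) (expo w) => a b c d ab aa.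
rewrite mulrN -opprD; congr (- _)%R; rewrite mulrDr addrC; congr (_ + _)%R.
  by rewrite mulrAC ab mulrC.
by rewrite mulrACA aa mul1r.
Qed.

Lemma expo_bound w : (`|expo w| <= size w)%N.
Proof.
elim: w => [//|z w]; rewrite /= /expo1 /sign1; set t := expo w.
by do ![case: ifP => _]; lia.
Qed.

Lemma expo_cochain (G : finGroupType) (g : 'I_n -> G) : generated g ->
  (forall w, word_eval g w = 1 -> sign w = 1%R) ->
  exists (c : G -> 'I_n -> int) (s : G -> int), s 1 = 1%R /\
    forall x w, integral g c x w = (s x * expo w)%R.
Proof.
move=> /choice[wd wdE] sign_closed; pose s x := sign (wd x).
have sM x z : s (x * letter_eval g z) = (s x * sign1 z)%R.
  have := sign_closed ((wd x ++ [:: z]) ++ word_inv (wd (x * letter_eval g z))).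
  rewrite !word_eval_cat word_eval_inv !wdE /= mulg1 mulgV => /(_ erefl).
  rewrite !sign_cat sign_inv sign_seq1 -/(s x) -/(s _) => e.
  by rewrite -[LHS]mul1r -{1}e -[LHS]mulrA sign_sqr mulr1.
exists (fun x a => s x * (a == l.1)%:R)%R, s; split.
  by apply: sign_closed; rewrite wdE.
move=> x w; elim: w x => [|z w IH] x; first by rewrite /= mulr0.
rewrite /= IH sM mulrDr mulrA; congr (_ + _)%R.
rewrite -sign1_expo1 mulrA -sM /step /expo1 /letter_eval; case: z => a [] /=.
  by case: eqP; rewrite ?mulr0 ?oppr0 // mulrN.
case: (a =P l.1) => [al|_]; last by rewrite !mulr0.
by have := sM x (a, false); rewrite /letter_eval /= => ->; rewrite /sign1 /= al;
  case: eqP; rewrite ?mulr1.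
Qed.

End SignedHom.

Section Directions.
Variable n : nat.
Implicit Types (l : 'I_n * 'I_n) (w : seq (letter 'I_n)).

(* The diagonal pairs come last because [dual_word (a, a) q] also pairs nontrivially
   with the directions [(a, b)]. *)
Definition directions (p : nat) : seq ('I_n * 'I_n) :=
  if p == 2 then
    [seq l <- enum {: 'I_n * 'I_n} | l.1 != l.2] ++
    [seq l <- enum {: 'I_n * 'I_n} | l.1 == l.2]
  else [seq l <- enum {: 'I_n * 'I_n} | l.1 == l.2].

Lemma size_directions p : size (directions p) = if p == 2 then (n * n)%N else n.
Proof.
have diag : size [seq l <- enum {: 'I_n * 'I_n} | l.1 == l.2] = n.
  transitivity (size [seq (a, a) | a <- enum 'I_n]);
    last by rewrite size_map size_enum_ord.
  apply: seq.perm_size; apply: uniq_perm; first by rewrite filter_uniq ?enum_uniq.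
    by rewrite map_inj_uniq ?enum_uniq // => a b [].
  move=> [a b]; rewrite mem_filter mem_enum andbT /=; apply/eqP/mapP.
    by move=> ->; exists b; rewrite ?mem_enum.
  by case=> c _ [-> ->].
rewrite /directions; case: ifP => _ //.
by rewrite size_cat !size_filter addnC count_predC -cardE card_prod card_ord.
Qed.

Lemma directions_uniq p : uniq (directions p).
Proof.
have u a : uniq [seq l <- enum {: 'I_n * 'I_n} | a l] by exact: filter_uniq
  (enum_uniq _).
rewrite /directions; case: ifP => _; last exact: u.
rewrite cat_uniq !u andbT; apply/hasPn => l.
by rewrite !mem_filter => /andP[/eqP ->]; rewrite eqxx.
Qed.

Lemma directions_diag p l : p != 2 -> l \in directions p -> l.1 = l.2.
Proof. by move=> /negbTE p2; rewrite /directions p2 mem_filter => /andP[/eqP]. Qed.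

Lemma directions_order p l0 j k : k < j -> j < size (directions p) ->
  let l := nth l0 (directions p) in (l k).1 = (l k).2 -> (l j).1 <> (l k).1.
Proof.
move=> kj js l lk lj.
have ks : k < size (directions p) by exact: ltn_trans kj js.
have ljd : (l j).1 = (l j).2.
  have := mem_nth l0 js; rewrite -/(l j); case: (eqVneq p 2) => [p2|p2];
    last exact: directions_diag.
  move=> _; apply/eqP; move: lk js; rewrite /l /directions p2 eqxx.
  set s1 := [seq _ <- _ | _ != _]; set s2 := [seq _ <- _ | _ == _].
  rewrite !nth_cat size_cat; case: (ltnP k (size s1)) => k1.
    by have := mem_nth l0 k1; rewrite mem_filter => /andP[/eqP].
  have j1 : size s1 <= j by exact: leq_trans k1 (ltnW kj).
  rewrite [j < size s1]ltnNge j1 /= => _ js2;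
    have : j - size s1 < size s2 by rewrite ltn_subLR.
  by move/(mem_nth l0); rewrite mem_filter => /andP[].
have : l j = l k.
  by move: lk ljd lj; case: (l k) => a b; case: (l j) => c e /= -> -> ->.
move/eqP; rewrite /l nth_uniq ?directions_uniq // => /eqP ejk.
by rewrite ejk ltnn in kj.
Qed.

(** For [l = (a, b)] off the diagonal this is the commutator of [a ^ q] and [b]. The two runs of [a]
    cancel in an ordinary count, whereas the sign change at [b] makes them add up to [2 * q]. *)
Definition dual_word l (q : nat) : seq (letter 'I_n) :=
  if l.1 == l.2 then nseq q (l.1, false)
  else nseq q (l.1, false) ++ (l.2, false) :: nseq q (l.1, true) ++ [:: (l.2, true)].

Lemma size_dual_word l q : size (dual_word l q) <= (q + q).+2.
Proof.
rewrite /dual_word; case: ifP => _; rewrite ?size_nseq; first lia.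
by rewrite size_cat /= size_cat !size_nseq /=; lia.
Qed.

Lemma word_eval_nseq_letter (G : groupType) (f : 'I_n -> G) q (z : letter 'I_n) :
  word_eval f (nseq q z) = letter_eval f z ^+ q.
Proof. by elim: q => [|q IH] //=; rewrite IH expgS. Qed.

Lemma word_eval_dual_word (G : groupType) (f : 'I_n -> G) l q :
  f l.1 ^+ q = 1 -> word_eval f (dual_word l q) = 1.
Proof.
move=> fq; rewrite /dual_word; case: ifP => _.
  by rewrite word_eval_nseq_letter.
rewrite word_eval_cat /= word_eval_cat !word_eval_nseq_letter /= /letter_eval /=.
by rewrite expgVn fq invg1 mulg1 !mul1g mulgV.
Qed.

Lemma expo_nseq l q (z : letter 'I_n) :
  expo l (nseq q z) = (expo1 l z *+ q)%R.
Proof. by elim: q => [//|q IH] /=; rewrite IH mulrnAr sign1_expo1 mulrS. Qed.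

Lemma sign_nseq_even l q (z : letter 'I_n) : ~~ odd q -> sign l (nseq q z) = 1%R.
Proof.
move=> q2; rewrite -(odd_double_half q) (negbTE q2) add0n.
elim: q./2 => [|k IH]; first exact: big_nil.
by rewrite doubleS /= !sign_cons mulrA sign1_sqr mul1r.
Qed.

Lemma expo_dual_diag l l' q : l.1 = l.2 ->
  expo l' (dual_word l q) = ((l'.1 == l.1)%:R *+ q)%R.
Proof.
move=> ll; rewrite /dual_word ll eqxx expo_nseq /expo1 /= eq_sym.
by case: eqP.
Qed.

Lemma expo_dual_off l l' q : ~~ odd q -> l.1 != l.2 ->
  expo l' (dual_word l q) = (if l' == l then 2%:R *+ q else 0)%R.
Proof.
move=> q2 ll; rewrite /dual_word (negbTE ll) expo_cat /= expo_cat !expo_nseq.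
rewrite !sign_nseq_even // !mul1r /= mulr0 addr0.
move: ll; case: l => a b; case: l' => c e /= ab; rewrite /expo1 /sign1 /= xpair_eqE.
case: (a =P c) => [<-|/eqP ac]; case: (b =P e) => [<-|/eqP be].
- rewrite (eq_sym b) (negbTE ab) !eqxx /= mulNrn addr0 add0r mulN1r opprK.
  by rewrite -mulrnDl.
- by rewrite (eq_sym b) (negbTE ab) (eq_sym e) (negbTE be) andbF !andbF mulNrn mul1r
  addr0 add0r subrr.
- rewrite (eq_sym c a) (negbTE ac) mul0rn !add0r andbT /=.
  by case: (b =P c) => [->|]; rewrite ?eqxx /= ?mul1r ?subrr // mulr0.
- rewrite (eq_sym c a) (negbTE ac) mul0rn !add0r andbF mul1r /=.
  by case: eqP; rewrite ?subrr.
Qed.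

End Directions.

Lemma sign_of_exponent_sum (n : nat) (G : finGroupType) (g : 'I_n -> G)
    (l : 'I_n * 'I_n) w x :
  (2 %| integral g (fun _ b => (b == l.2)%:R%R : int) x w)%Z -> sign l w = 1%R.
Proof.
suff -> : sign l w = if l.1 == l.2 then 1%R else
  if (2 %| integral g (fun _ b => (b == l.2)%:R%R : int) x w)%Z then 1%R else (-1)%R.
  by move=> ->; case: ifP.
elim: w x => [|[a b] w IH] x /=.
  by rewrite /sign big_nil; case: ifP.
rewrite sign_cons (IH (x * letter_eval g (a, b))) /sign1 /step /=.
case: (l.1 == l.2) => //=; set t := integral _ _ _ _.
have oddD (u v : int) : (2 %| (u + v)%R)%Z = ((2 %| u)%Z == (2 %| v)%Z) by lia.
by rewrite oddD; clearbody t; clear IH; case: b; case: (a == l.2); case: (2 %| t)%Z.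
Qed.

(** * One step of the tower of p-groups *)

Definition same_kernel (n : nat) (G G' : groupType) (g : 'I_n -> G) (g' : 'I_n ->
  G') :=
  forall w, word_eval g w = 1 <-> word_eval g' w = 1.

(** Since [betti] decreases with the radius, it equals [d - k] on the whole range from [s k] to
    [B * s k]. *)
Definition betti_staircase (n : nat) (G : finGroupType) (g : 'I_n ->
  G) (B d : nat) (s : nat -> nat) :=
  [/\ B <= s 0, forall k, s k <= s k.+1 &
    forall k, k <= d -> betti g (s k) <= d - k /\ d - k <= betti g (B * s k)].

Lemma integral_scale (A : choiceType) (G : groupType) (g : A -> G)
    (N : int) (c : G -> A -> int) x w :
  integral g (fun x a => N * c x a)%R x w = (N * integral g c x w)%R.
Proof.
elim: w x => [|[a b] w IH] x /=; first by rewrite mulr0.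
by rewrite IH mulrDr /step /=; case: b; rewrite ?mulrN.
Qed.

(** One extension raises the girth and trivializes the signs on closed words; a second one creates
    the staircase. All groups with the same kernel are allowed because the box space provides only a
    copy of [G]. *)
Lemma tower_step (n p l B : nat) (P : finGroupType) (f : 'I_n -> P) :
  0 < n -> prime p -> p.-nat #|P| -> girth_gt f l ->
  exists (G : finGroupType) (g : 'I_n -> G),
  [/\ generated g, p.-nat #|G|, girth_gt g l.+1,
      forall w, word_eval g w = 1 -> word_eval f w = 1
    & exists s, forall (G' : finGroupType) (g' : 'I_n -> G'), generated g' ->
        same_kernel g' g -> betti_staircase g' B (if p == 2 then (n * n)%N else n) s].
Proof.
move=> n0 pp pP gir.
have [P1 [f1 [gen1 pP1 gir1 ker1]]] := girth_extension pp pP gir.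
pose d := if p == 2 then (n * n)%N else n.
pose l0 : 'I_n * 'I_n := (Ordinal n0, Ordinal n0).
pose dir k := nth l0 (directions n p) k.
have dE : size (directions n p) = d by exact: size_directions.
have /p_natP[m cP1] := pP1.
have sign_closed k w : k < d -> word_eval f1 w = 1 -> sign (dir k) w = 1%R.
  move=> kd /ker1[_ dvd]; case: (eqVneq (dir k).1 (dir k).2) => [e|ne].
    by rewrite /sign big1 // => z _; rewrite /sign1 e eqxx.
  apply: (@sign_of_exponent_sum _ _ f _ _ 1).
  case: (eqVneq p 2) => [p2|p2]; first by have := dvd (dir k).2; rewrite p2.
  by move/eqP: ne; case; apply: (directions_diag p2); rewrite mem_nth ?dE.
have p0 := prime_gt0 pp.
have pe_gt0 e : 0 < p ^ e by rewrite expn_gt0 p0.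
have even_q k e : k < d -> m.+1 <= e -> (dir k).1 != (dir k).2 -> ~~ odd (p ^ e)%N.
  move=> kd me ne; case: (eqVneq p 2) => [->|p2].
    by rewrite oddX orbF -lt0n (leq_trans _ me).
  by move/eqP: ne; case; apply: (directions_diag p2); rewrite mem_nth ?dE.
have f1_pow a e : m < e -> f1 a ^+ (p ^ e)%N = 1.
  move=> me; rewrite -(subnK (ltnW me)) expnD mulnC expgM -cP1.
  by rewrite -cardsT expg_cardG ?inE // expg1n.
(* Exponent [m] already kills the generators of [P1]. One more makes [p ^ e] even for [p = 2] even
   if [P1] is trivial. *)
have [|||||||||||s0 [Bs0 s0P]] := @betti_gaps n P1 f1 p d m.+1 B
    (fun k => expo (dir k)) (fun k => sign (dir k)) (fun k =>
      dual_word (dir k)) gen1 pp.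
- by [].
- by move=> k u v; exact: expo_cat.
- by move=> k w; exact: sign_closed.
- by move=> k w s1; rewrite expo_inv s1 mul1r.
- by move=> k w; exact: expo_bound.
- move=> G g gen ker k kd; apply: expo_cochain => // w w1.
  by apply: sign_closed => //; apply: ker.
- by move=> k e kd me; apply: word_eval_dual_word; exact: f1_pow.
- by move=> k q; exact: size_dual_word.
- move=> k e kd me; case: (eqVneq (dir k).1 (dir k).2) => [ll|ll].
    by rewrite expo_dual_diag // eqxx => /eqP; rewrite pnatr_eq0 (gtn_eqF (pe_gt0 e)).
  rewrite expo_dual_off ?(even_q k) // eqxx => /eqP.
  by rewrite mulrn_eq0 (gtn_eqF (pe_gt0 e)).
- move=> j k e kj jd me; case: (eqVneq (dir k).1 (dir k).2) => [ll|ll].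
    rewrite expo_dual_diag //; case: eqP => [e1|]; last by rewrite mul0rn.
    by have := @directions_order n p l0 j k kj; rewrite dE => /(_ jd ll e1).
  rewrite expo_dual_off ?(even_q k) ?(ltn_trans kj jd) // nth_uniq ?directions_uniq
    ?dE //.
    by rewrite gtn_eqF.
  exact: ltn_trans kj jd.
- move=> j k e jk kd me; case: (eqVneq (dir k).1 (dir k).2) => [ll|ll].
    by rewrite expo_dual_diag // -mulr_natr dvdz_mull // natz dvdzz.
  rewrite expo_dual_off ?(even_q k) //; case: eqP => _; last exact: dvdz0.
  by rewrite -mulr_natr dvdz_mull // natz dvdzz.
have cochains k : exists c : P1 -> 'I_n -> int, k < d -> exists s : P1 -> int,
  s 1 = 1%R /\
    forall x w, integral f1 c x w = (s x * expo (dir k) w)%R.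
  case: (ltnP k d) => kd; last by exists (fun _ _ => 0%R).
  have [|c cP] := @expo_cochain n (dir k) _ _ gen1; first by move=> w;
    apply: sign_closed.
  by exists c.
have [c cP] := choice cochains.
pose lev := level p m.+1 B s0; pose E := lev d.
have levE (k : 'I_d) : lev k <= E by apply: level_le; apply: ltnW.
(* A single modulus [p ^ E] serves all directions: the factor [p ^ (E - lev k)] leaves a condition
   modulo [p ^ lev k]. *)
have [G [g [gen pG gE]]] := period_extension f1
  (fun (k : 'I_d) x a => (p ^ (E - lev k))%N%:Z * c k x a)%R pp (leq_addr _ _ : 0 <
    E) pP1.
have kerG w : word_eval g w = 1 <-> word_eval f1 w = 1 /\
    forall k, k < d -> ((p ^ lev k)%N %| expo (dir k) w)%Z.
  have dvdE (k : 'I_d) x : ((p ^ E)%N %| integral f1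
      (fun x a => (p ^ (E - lev k))%N%:Z * c k x a)%R x w)%Z =
      ((p ^ lev k)%N %| integral f1 (c k) x w)%Z.
    have -> : ((p ^ E)%N%:Z = (p ^ (E - lev k))%N%:Z * (p ^ lev k)%N%:Z)%R.
      by rewrite -PoszM -expnD subnK.
    rewrite integral_scale dvdz_mul2l //.
    by rewrite eqz_nat gtn_eqF.
  split=> [/gE[w1 dvd]|[w1 dvd]].
    split => // k kd; have [s [s1 int]] := cP k kd.
    by have := dvd (Ordinal kd) 1; rewrite dvdE int s1 mul1r.
  apply/gE; split => // k x; rewrite dvdE.
  by have [s [_ ->]] := cP k (ltn_ord k); rewrite dvdz_mull // dvd.
exists G, g; split => //.
- by move=> w rw sw /kerG[w1 _]; apply: gir1.
- by move=> w /kerG[/ker1[]].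
exists (scale p m.+1 B s0) => G' g' gen' ker'; split => //.
  by move=> k; apply: scale_le.
by move=> k kd; apply: s0P => // w; rewrite ker'.
Qed.

(** * Quasi-isometric finite quotients *)

Lemma line_integral_translate (m : nat) (H : finGroupType) (h : 'I_m -> H) c x y w :
  line_integral h (translate x c) y w = line_integral h c (x * y) w.
Proof.
rewrite /line_integral; elim: w y => [//|[a b] w IH] y /=; rewrite IH -mulgA.
by rewrite /step /=; case: b; rewrite /= ffunE /= ?mulgA.
Qed.

Lemma cocycles_translate (m : nat) (H : finGroupType) (h : 'I_m -> H) r x c :
  c \in cocycles h r -> translate x c \in cocycles h r.
Proof.
move=> /cocyclesP cz; apply/cocyclesP => y w sw w1.
by rewrite line_integral_translate cz.
Qed.

Lemma bettiS (m : nat) (H : finGroupType) (h : 'I_m -> H) r r' :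
  r <= r' -> betti h r' <= betti h r.
Proof. by move=> rr; rewrite /betti leq_sub2r // dimvS // cocyclesS. Qed.

Lemma girth_gtS (m : nat) (H : finGroupType) (h : 'I_m -> H) r r' :
  r <= r' -> girth_gt h r' -> girth_gt h r.
Proof. by move=> rr gir w rw sw; apply: gir => //; apply: leq_trans rr. Qed.

Section QuasiIsometry.
Variables (n m A : nat) (G H : finGroupType) (g : 'I_n -> G) (h : 'I_m -> H).
Variables (phi : H -> G) (psi : G -> H).
Hypotheses (A_gt0 : 0 < A) (gen_g : generated g) (gen_h : generated h).
Hypotheses (lip_phi : lipschitz h g A phi) (lip_psi : lipschitz g h A psi).
Hypothesis phiK : forall y, near_by g A y (phi (psi y)).
Hypothesis psiK : forall x, near_by h A x (psi (phi x)).

(** For positive [A], [(A + 1) ^ 2 = A * (A + 2) + 1] is at most [A * (A + 3)]; this is the origin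
    of [A + 3]. *)
Let large_scale r : A + 3 <= r -> ((A + 1) ^ 2 <= A * r)%N.
Proof. move=> Ar; apply: leq_trans (leq_mul (leqnn A) Ar); rewrite expnS expn1;
  nia. Qed.

(** Below the girth the Betti numbers do not depend on the radius, so the two inequalities of
    [betti_lipschitz] meet. *)
Lemma quasi_isometry_rank :
  girth_gt g (A * (A + 3)) -> girth_gt h (A * (A + 3)) ->
  (n.-1 * #|G| = m.-1 * #|H|)%N.
Proof.
move=> gg gh; have Ar := large_scale (leqnn (A + 3)).
have le_r : A + 3 <= A * (A + 3) by rewrite leq_pmull.
have bg := betti_girth gen_g gg; have bh := betti_girth gen_h gh.
have bg' := betti_girth gen_g (girth_gtS le_r gg).
have bh' := betti_girth gen_h (girth_gtS le_r gh).
have b1 := betti_lipschitz lip_phi lip_psi phiK Ar.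
have b2 := betti_lipschitz lip_psi lip_phi psiK Ar.
have G0 : 0 < #|G| by apply/card_gt0P; exists 1.
have H0 : 0 < #|H| by apply/card_gt0P; exists 1.
move: (betti g _) (betti g _) (betti h _) (betti h _) bg bh bg' bh' b1 b2.
move=> b1 b2 b3 b4.
rewrite -!subn1 !mulnBl !mul1n; lia.
Qed.

Lemma quasi_isometry_staircase B d s (R : seq H) :
  (A * A <= B)%N -> A + 3 <= B -> betti_staircase g B d s ->
  (forall x, exists t r, [/\ t \in square_group H, r \in R & x = t * r]) ->
  (d <= size R * m)%N.
Proof.
move=> AB A3B [Bs0 s_le sP] Rrep.
have s_mono j k : j <= k -> s j <= s k.
  by move/subnK <-; elim: (k - j) => [//|i IH]; rewrite addSn;
    apply: leq_trans IH (s_le _).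
have s_large k : A + 3 <= s k.
  exact: leq_trans A3B (leq_trans Bs0 (s_mono 0 k (leq0n k))).
have bettiH k : k <= d -> betti h (A * s k) = d - k.
  move=> kd; have [up low] := sP k kd; apply/eqP; rewrite eqn_leq; apply/andP; split.
    by apply: leq_trans up; apply: betti_lipschitz lip_psi lip_phi psiK (large_scale
      (s_large k)).
  apply: leq_trans low _; apply: (@leq_trans (betti g (A * (A * s k)))).
    by apply: bettiS; rewrite mulnA leq_mul2r AB orbT.
  apply: betti_lipschitz lip_phi lip_psi phiK _; apply: large_scale.
  by apply: leq_trans (s_large k) _; rewrite leq_pmull.
(* The minimum freezes the flag after [d], so that each step drops the dimension by at most one. *)
pose W k := cocycles h (A * s (minn k d)).
have dimW k : \dim (W k) = \dim (coboundaries h) + (d - minn k d).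
  rewrite -bettiH ?geq_minr // /betti subnKC // dimvS //.
  exact: coboundaries_sub.
have := @dim_flag m H W _ _ _ d R Rrep; rewrite !dimW minnn min0n subnn subn0 addn0.
rewrite leq_add2l; apply.
- by move=> k x c; apply: cocycles_translate.
- by move=> k; apply: cocyclesS; rewrite leq_mul2l s_mono ?orbT //; lia.
- by move=> k; rewrite !dimW; lia.
Qed.

End QuasiIsometry.

Lemma no_quasi_isometry (n m A B : nat) (G H : finGroupType) (g : 'I_n -> G)
    (h : 'I_m -> H) (phi : H -> G) (psi : G -> H) (s : nat -> nat) :
  let p := pdiv n.-1 in
  3 <= n -> 0 < m -> coprime m.-1 n.-1 -> 0 < A ->
  generated g -> generated h -> lipschitz h g A phi -> lipschitz g h A psi ->
  (forall y, near_by g A y (phi (psi y))) ->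
  (forall x, near_by h A x (psi (phi x))) ->
  girth_gt g (A * (A + 3)) -> girth_gt h (A * (A + 3)) ->
  (A * A <= B)%N -> A + 3 <= B -> p.-nat #|G| ->
  betti_staircase g B (if p == 2 then (n * n)%N else n) s -> False.
Proof.
move=> p n3 m0 co A0 gen_g gen_h lphi lpsi phiK psiK gg gh AB A3B pG stair.
have n1 : 1 < n.-1 by lia.
have pp : prime p by exact: pdiv_prime.
have rk := quasi_isometry_rank A0 gen_g gen_h lphi lpsi phiK psiK gg gh.
have m2 : m = 2.
  have : (m.-1 %| n.-1 * #|G|)%N by rewrite rk dvdn_mulr.
  rewrite Gauss_dvdr // => dvd; have /p_natP[k ck] := pG.
  have cop : coprime m.-1 #|G|.
    by rewrite ck coprimeXr // (coprime_dvdr (pdiv_dvd _) co).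
  have : m.-1 %| 1 by rewrite -(eqP cop) dvdn_gcd dvdnn.
  by rewrite dvdn1 => /eqP; lia.
subst m; have cH : (#|H| = n.-1 * #|G|)%N by rewrite rk mul1n.
have key R := @quasi_isometry_staircase n 2 A G H g h phi psi A0 lphi lpsi phiK psiK
  B _ s R AB A3B stair.
case: (eqVneq p 2) key => [p2|p2] key.
  have := key _ (square_group_cosets2 gen_h); rewrite /=; nia.
have oddp : odd p by case: (even_prime pp) => // p2'; rewrite p2' in p2.
have oddH : odd #|H|.
  have /p_natP[k ck] := pG; rewrite cH oddM ck oddX oddp orbT andbT.
  apply: contraNT p2; rewrite -dvdn2 => /(pdiv_min_dvd (isT : 1 < 2)).
  by rewrite -/p eqn_leq => ->; rewrite prime_gt1.
have := key [:: 1]; move=> /(_ _)/wrap[] //=.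
  by move=> x; exists x, 1; rewrite mulg1 inE eqxx square_group_odd.
by move: n3; lia.
Qed.

(** * Quotients of free groups and their metrics *)

Section Enumerated.
Variables (T : groupType) (s : seq T) (s_all : forall x, x \in s).

(** The proof that [s] is exhaustive is a parameter of the type, so that the group instance can
    recover it. *)
Definition enumerated (_ : forall x, x \in s) : Type := seq_sub s.
Local Notation E := (enumerated s_all).

HB.instance Definition _ := Finite.on E.

Definition enum_in (x : T) : E := SeqSub (s_all x).
Definition enum_out (u : E) : T := ssval u.

Lemma enum_inK : cancel enum_in enum_out. Proof. by []. Qed.
Lemma enum_outK : cancel enum_out enum_in. Proof. by move=> u; apply: val_inj. Qed.

Fact enumerated_mulA : associative (fun u v : E => enum_in (enum_out u * enum_out v)).
Proof. by move=> u v w; apply: val_inj; apply: mulgA. Qed.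
Fact enumerated_mul1 : left_id (enum_in 1) (fun u v : E =>
  enum_in (enum_out u * enum_out v)).
Proof. by move=> u; apply: val_inj; apply: mul1g. Qed.
Fact enumerated_mulV : left_inverse (enum_in 1) (fun u : E => enum_in (enum_out u)^-1)
  (fun u v : E => enum_in (enum_out u * enum_out v)).
Proof. by move=> u; apply: val_inj; apply: mulVg. Qed.

HB.instance Definition _ :=
  Finite_isGroup.Build E enumerated_mulA enumerated_mul1 enumerated_mulV.

Lemma enum_inM : {morph enum_in : x y / x * y}.
Proof. by move=> x y; apply: val_inj. Qed.

End Enumerated.

Lemma finite_group_model (T : groupType) : finite_set [set: T] ->
  exists (G : finGroupType) (i : T -> G) (o : G -> T),
  [/\ cancel i o, cancel o i & {morph i : x y / x * y}].
Proof.
move=> /finite_seqP[s sE].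
have s_all x : x \in s.
  have : ([set` s] x)%classic by rewrite -sE.
  by [].
exists (enumerated s_all), (enum_in s_all), (@enum_out _ _ s_all).
by split; [exact: enum_inK|exact: enum_outK|exact: enum_inM].
Qed.

Section QuotientWords.
Variables (A : choiceType) (N : normalSubgroup (free_group A)).

Definition quot_gen (a : A) : quotient_group N := quot_map N (fg_gen a).

Lemma quot_map_words (x : free_group A) : quot_map N x = word_eval quot_gen x.
Proof. exact: (fg_lift_unique (@quot_mapM _ N) (fun a => erefl)). Qed.

Lemma word_eval_quot_gen w : word_eval quot_gen w = quot_map N (fg_of_word w).
Proof. by rewrite quot_map_words /= word_eval_reduce. Qed.

Lemma quot_map_surj (u : quotient_group N) : exists x, quot_map N x = u.
Proof. by elim/quotW: u => x; exists x. Qed.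

Lemma quot_gen_generated : generated quot_gen.
Proof.
by move=> u; have [x <-] := quot_map_surj u; exists x; rewrite -quot_map_words.
Qed.

Lemma quot_map_eq1 x : (quot_map N x = 1) <-> x \in N.
Proof.
have q1 : quot_map N 1 = 1 by rewrite quot_map_words.
rewrite -q1; split => [/eqP|xN].
  by rewrite quot_map_eq mulg1 => /(group_closedV (nsg_closed N)); rewrite invgK.
by apply/eqP; rewrite quot_map_eq mulg1; apply: (group_closedV (nsg_closed N)).
Qed.

End QuotientWords.

Section NearBy.
Variables (A : choiceType) (G : groupType) (f : A -> G).

Lemma near_by_refl k x : near_by f k x x.
Proof. by exists [::]; rewrite mulg1. Qed.

Lemma near_by_sym k x y : near_by f k x y -> near_by f k y x.
Proof.
by move=> [w [sw ->]]; exists (word_inv w); rewrite size_word_inv word_eval_inv mulgK.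
Qed.

Lemma near_by_trans k l x y z : near_by f k x y -> near_by f l y z ->
  near_by f (k + l) x z.
Proof.
move=> [u [su ->]] [v [sv ->]]; exists (u ++ v).
by rewrite size_cat leq_add // word_eval_cat mulgA.
Qed.

Lemma near_byS k l x y : k <= l -> near_by f k x y -> near_by f l x y.
Proof. by move=> kl [w [sw ->]]; exists w; rewrite (leq_trans sw). Qed.

End NearBy.

Section Cayley.
Variables (G : groupType) (S : seq G).
Local Notation edge := (cayley_edge S).

Lemma cayley_edge_sym : symmetric edge.
Proof. by move=> x y; apply: eq_has => s; rewrite orbC. Qed.

Lemma cayley_edge_mul z x y : edge (z * x) (z * y) = edge x y.
Proof. by apply: eq_has => s /=; rewrite -!mulgA !(inj_eq (mulgI z)). Qed.

Definition linked k x y := exists p, [/\ path edge x p, last x p = y & size p <= k].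

Lemma linked_refl k x : linked k x x. Proof. by exists [::]. Qed.

Lemma linked_trans k l x y z : linked k x y -> linked l y z -> linked (k + l) x z.
Proof.
move=> [p [pp py ps]] [q [qp qz qs]]; exists (p ++ q).
by rewrite cat_path pp py qp last_cat py qz size_cat leq_add.
Qed.

Lemma linked_sym k x y : linked k x y -> linked k y x.
Proof.
move=> [p [pp py ps]]; exists (rev (belast x p)); split.
- by rewrite -py rev_path; apply: (sub_path _ pp) => u v; rewrite cayley_edge_sym.
- by case: p py {pp ps} => [<-|a p _] //=; rewrite rev_cons last_rcons.
- by rewrite size_rev size_belast.
Qed.

Lemma linkedS k l x y : k <= l -> linked k x y -> linked l x y.
Proof. by move=> kl [p [pp py ps]]; exists p; split => //; apply: leq_trans kl. Qed.

Lemma linked_edge k x s : s \in S -> linked k.+1 x (x * s).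
Proof.
move=> sS; exists [:: x * s]; split => //=; rewrite andbT.
by apply/hasP; exists s; rewrite ?eqxx.
Qed.

Lemma linked_mul k z x y : linked k x y -> linked k (z * x) (z * y).
Proof.
move=> [p [pp <- ps]]; exists [seq z * u | u <- p].
rewrite last_map size_map; split => //.
by rewrite path_map; apply: (sub_path _ pp) => u v; rewrite /= cayley_edge_mul.
Qed.

Lemma generates_linked : generates S -> forall x, exists k, linked k 1 x.
Proof.
move=> gen x; pose H : {pred G} := [pred y | `[< exists k, linked k 1 y >]].
have : x \in H; last by move=> /asboolP.
apply: gen; last first.
  by move=> s sS; apply/asboolP; exists 1%N; have := linked_edge 0 1 sS;
    rewrite mul1g.
split; first by apply/asboolP; exists 0; exact: linked_refl.
move=> u v /asboolP[k uk] /asboolP[l vl]; apply/asboolP.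
exists (k + l); apply: linked_trans uk _.
have := linked_mul (u * v^-1) (linked_sym vl).
by rewrite mulg1 mulgVK.
Qed.

Section Distance.
Variable R : realType.

Lemma cayley_dist_le k x y : linked k x y -> (cayley_dist R S x y <= k%:R)%R.
Proof.
move=> [p [pp py ps]]; apply: (@le_trans _ _ (size p)%:R%R); last by rewrite ler_nat.
apply: ge_inf; first by exists 0%R => _ [q _ <-].
by exists p.
Qed.

Lemma cayley_dist_nat x y : (exists k, linked k x y) ->
  exists2 k, linked k x y & cayley_dist R S x y = k%:R%R.
Proof.
move=> ex; have [] := @ex_minnP (fun k => `[< linked k x y >]).
  by case: ex => k xy; exists k; apply/asboolP.
move=> k /asboolP xy kmin; exists k => //; apply/eqP;
  rewrite eq_le cayley_dist_le //=.
apply: lb_le_inf; first by case: xy => p [pp py _]; exists (size p)%:R%R; exists p.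
move=> _ [p [pp py] <-]; rewrite ler_nat; apply: kmin; apply/asboolP.
by exists p.
Qed.

End Distance.
End Cayley.

Section QuotientMetric.
Variables (n : nat) (S : seq (free_group 'I_n)).
Implicit Type N : normalSubgroup (free_group 'I_n).

Definition quot_seq N : seq (quotient_group N) := map (@quot_map _ N) S.

Lemma near_of_linked : exists C, forall N x y k,
  linked (quot_seq N) k x y -> near_by (quot_gen N) (C * k) x y.
Proof.
exists (\max_(s <- S) size (fg_word s)) => N x y k [p [pp <- ps]].
set C := \max_(s <- S) _; apply: (near_byS (k := C * size p)).
  by rewrite leq_mul2l ps orbT.
elim: p x pp {ps} => [|z p IH] x /=; first by move=> _; exact: near_by_refl.
move=> /andP[/hasP[_ /mapP[s sS ->] xz] pp]; rewrite mulnS.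
apply: near_by_trans (IH z pp).
have near_s u : near_by (quot_gen N) C u (u * quot_map N s).
  exists (fg_word s); rewrite -quot_map_words; split => //.
  by rewrite /C (big_rem s) //= leq_maxl.
by case/orP: xz => /eqP ->; [exact: near_s|apply/near_by_sym/near_s].
Qed.

Lemma linked_of_near : generates S -> exists C, forall N x y k,
  near_by (quot_gen N) k x y -> linked (quot_seq N) (C * k) x y.
Proof.
move=> gen; have [K KP] := choice (fun a => generates_linked gen (fg_gen a)).
pose C := \max_(a : 'I_n) K a.
exists C => N x y k [w [sw ->]]; apply: (linkedS (k := C * size w)).
  by rewrite leq_mul2l sw orbT.
have quot_linked l u v : linked S l u v ->
  linked (quot_seq N) l (quot_map N u) (quot_map N v).
  move=> [p [pp <- ps]]; exists (map (@quot_map _ N) p).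
  rewrite last_map size_map; split => //; rewrite path_map.
  apply: (sub_path _ pp) => a b /hasP[s sS] /= ab; apply/hasP.
  exists (quot_map N s); first by apply/mapP; exists s.
  by case/orP: ab => /eqP ->; rewrite quot_mapM eqxx ?orbT.
have gen_linked u a : linked (quot_seq N) C u (u * quot_gen N a).
  have := linked_mul u (quot_linked _ _ _ (KP a)).
  have -> : quot_map N 1 = 1 by rewrite quot_map_words.
  by rewrite mulg1; apply: linkedS; rewrite /C (bigD1 a) //= leq_maxl.
elim: w x {sw} => [|[a b] w IH] x; first by rewrite /= mulg1; exact: linked_refl.
rewrite /= mulgA mulnS; apply: linked_trans (IH _).
case: b; rewrite /letter_eval /=; last exact: gen_linked.
by apply: linked_sym; rewrite -{2}(mulgVK (quot_gen N a) x); exact: gen_linked.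
Qed.

Variable R : realType.
Local Notation dist N := (cayley_dist R (quot_seq N)).

(** [C] does not depend on [N]: one constant serves all components of a box space. *)
Lemma quot_metric : generates S -> exists C, 0 < C /\ forall N,
  [/\ forall x y k, (dist N x y <= k%:R)%R -> near_by (quot_gen N) (C * k) x y,
      forall x y k, near_by (quot_gen N) k x y -> (dist N x y <= (C * k)%:R)%R
    & forall x y, exists k, dist N x y = k%:R%R].
Proof.
move=> gen; have [C1 C1P] := near_of_linked; have [C2 C2P] := linked_of_near gen.
exists (C1 + C2).+1; split => // N.
have conn x y : exists k, linked (quot_seq N) k x y.
  have [w wE] := @quot_gen_generated _ N (x^-1 * y).
  by exists (C2 * size w)%N; apply: C2P; exists w; rewrite wE mulKVg.
split.
- move=> x y k; have [j /C1P xy ->] := cayley_dist_nat R (conn x y).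
  rewrite ler_nat => jk; apply: near_byS xy; apply: leq_mul => //.
  by rewrite leqW // leq_addr.
- move=> x y k /C2P xy; apply: cayley_dist_le; apply: linkedS xy.
  by rewrite leq_mul2r leqW ?orbT // leq_addl.
by move=> x y; have [j _ ->] := cayley_dist_nat R (conn x y); exists j.
Qed.

Lemma dist_le_diam N x y : generates S -> finite_set [set: quotient_group N] ->
  (dist N x y <= cayley_diam R (quot_seq N))%R.
Proof.
move=> gen fin; have [C [_ /(_ N)[_ _ nat_dist]]] := quot_metric gen.
have [G [i [out [iK outK _]]]] := finite_group_model fin.
have [K KP] := choice (fun z : G * G => nat_dist (out z.1) (out z.2)).
apply: ub_le_sup; last by exists (x, y).
exists (\max_z K z)%:R%R => _ [[u v] _ <-] /=.
by rewrite -(iK u) -(iK v) (KP (i u, i v)) ler_nat leq_bigmax.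
Qed.

(** There are finitely many words of length at most [L]. Each nontrivial reduced one leaves the
    filtration at some stage and, by nesting, stays out. *)
Lemma filtration_girth (N : nat -> normalSubgroup (free_group 'I_n)) L :
  is_filtration N -> exists i0, forall i, i0 <= i -> girth_gt (quot_gen (N i)) L.
Proof.
move=> [nest _ triv].
have nested i j : i <= j -> {subset N j <= N i}.
  move/subnK <-; elim: (j - i) => [//|k IH] x; rewrite addSn => /nest; exact: IH.
have bad (w : L.-bseq ('I_n * bool)) : exists i,
    reduced (w : seq (letter 'I_n)) -> word_eval (quot_gen (N i)) w = 1 ->
      w = [::] :> seq _.
  apply: contrapT => /forallNP h.
  have [rw e] : reduced (w : seq (letter 'I_n)) /\ forall i,
    word_eval (quot_gen (N i)) w = 1.
    split; first by apply: contrapT => nr; apply: (h 0) => rw; case: nr.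
    by move=> i; apply: contrapT => ne; apply: (h i).
  have := triv (FreeGroup rw) => /(_ _)/wrap[].
    by move=> i; apply/quot_map_eq1; rewrite quot_map_words e.
  move=> w1; apply: (h 0) => _ _; exact: (congr1 (@fg_word _) w1).
have [I IP] := choice bad.
exists (\max_w I w) => i iI w rw sw w1.
apply: (IP (Bseq sw) rw) => /=; rewrite -(quot_map_words _ (FreeGroup rw)).
apply/quot_map_eq1; apply: (@nested _ i).
  by apply: leq_trans iI; apply: (leq_bigmax (Bseq sw)).
by apply/quot_map_eq1; rewrite quot_map_words.
Qed.

(** With diameter at most [D], the power [C * D + 1] of a generator would equal a word of length at
    most [C * D]; for large girth they would agree in the free group. *)
Lemma diam_unbounded (N : nat -> normalSubgroup (free_group 'I_n)) D :
  0 < n -> generates S -> is_filtration N ->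
  exists i0, forall i, i0 <= i -> (D%:R < cayley_diam R (quot_seq (N i)))%R.
Proof.
move=> n0 gen fil; have [C [C0 metric]] := quot_metric gen.
have [i0 i0P] := filtration_girth (C * D + (C * D).+1) fil.
exists i0 => i ii0; rewrite ltNge; apply/negP => diamD.
have [_ fin _] := fil.
set a : letter 'I_n := (Ordinal n0, false).
pose w := nseq (C * D).+1 a.
have rw : reduced w.
  by rewrite /w /reduced; elim: (C * D)%N => [//|k IH]; apply/andP; split.
have [near _ _] := metric (N i).
have [|u [su uw]] := near 1 (word_eval (quot_gen (N i)) w) D.
  by apply: le_trans diamD; apply: dist_le_diam => //; apply: fin.
pose v := reduce (w ++ word_inv u).
have v0 : v = [::].
  apply: (i0P i ii0); first exact: reduced_reduce.
    apply: leq_trans (size_reduce _) _;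
      rewrite size_cat size_word_inv size_nseq addnC.
    by rewrite leq_add2r.
  by rewrite word_eval_reduce word_eval_cat word_eval_inv uw mul1g mulgV.
have free x : word_eval (@fg_gen 'I_n) x = fg_of_word x.
  have := @fg_lift_unique _ _ (@fg_gen 'I_n) id (fun _ _ => erefl) (fun _ =>
    erefl) (fg_of_word x).
  by move=> ->; rewrite fg_liftE /= word_eval_reduce.
have : reduce w = reduce u.
  suff : fg_of_word w = fg_of_word u by move/(congr1 (@fg_word _)).
  have : word_eval (@fg_gen 'I_n) (w ++ word_inv u) = 1.
    by rewrite free; apply: val_inj.
  by rewrite word_eval_cat word_eval_inv !free => /(canRL (mulgVK _)); rewrite mul1g.
rewrite reduce_id // => wu; have := size_reduce u; rewrite -wu size_nseq => wu'.
by have := leq_trans wu' su; rewrite ltnn.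
Qed.

End QuotientMetric.

(** * Coarse equivalences of box spaces *)

Lemma proper_nneg_bound (R : realType) (rho : R -> R) (k : nat) : proper_nneg rho ->
  exists K : nat, forall t, (0 <= t)%R -> (rho t <= k%:R)%R -> (t <= K%:R)%R.
Proof.
move=> [rho0 prop].
have bk : bounded_set [set t : R | (0 <= t <= k%:R)%R]%classic.
  exists k%:R%R; split; first exact: num_real.
  by move=> M kM t /= /andP[t0 tk]; rewrite ger0_norm // (le_trans tk) // ltW.
have [M [_ MP]] := prop _ bk.
exists (Num.truncn (M + 1)%R).+1 => t t0 tk.
have := MP (M + 1)%R; rewrite ltrDl ltr01 => /(_ isT t) /= h.
have : (`|t| <= M + 1)%R by apply: h; rewrite t0 rho0 // tk.
rewrite ger0_norm // => /le_trans; apply; apply: ltW; exact: truncnS_gt.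
Qed.

Section BoxDistance.
Variables (R : realType) (n : nat) (S : seq (free_group 'I_n)).
Variable N : nat -> normalSubgroup (free_group 'I_n).
Local Notation dist := (box_dist R S (N := N)).
Local Notation diam i := (cayley_diam R (quot_seq S (N i))).

Lemma box_dist_same i (x y : quotient_group (N i)) :
  dist (existT _ i x) (existT _ i y) = cayley_dist R (quot_seq S (N i)) x y.
Proof. by rewrite /box_dist /= eqxx (@tagged_asE _ (fun k =>
  quotient_group (N k)) (existT _ i x) y). Qed.

Lemma box_dist_diff u v : tag u != tag v ->
  dist u v = (diam (tag u) + diam (tag v))%R.
Proof. by rewrite /box_dist => /negbTE ->. Qed.

Hypotheses (gen : generates S) (fil : is_filtration N).

Lemma diam_ge0 i : (0 <= diam i)%R.
Proof.
have [C [_ /(_ (N i))[_ _ /(_ 1 1)[k kE]]]] := quot_metric R gen.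
have [_ fin _] := fil.
by apply: le_trans (dist_le_diam R 1 1 gen (fin i)); rewrite kE.
Qed.

Lemma box_dist_ge0 u v : (0 <= dist u v)%R.
Proof.
case: (eqVneq (tag u) (tag v)) => [|/box_dist_diff ->];
  last by rewrite addr_ge0 ?diam_ge0.
case: u v => i x [j y] /= ij; case: _ / ij y => y; rewrite box_dist_same.
by have [C [_ /(_ (N i))[_ _ /(_ x y)[k ->]]]] := quot_metric R gen.
Qed.

Lemma box_dist_same_tag k u v :
  (k%:R < diam (tag u))%R -> (dist u v <= k%:R)%R -> tag u = tag v.
Proof.
move=> ku; case: (eqVneq (tag u) (tag v)) => // /box_dist_diff -> uvk.
have le_k : (diam (tag u) <= k%:R)%R by apply: le_trans uvk; rewrite lerDl diam_ge0.
by have := lt_le_trans ku le_k; rewrite ltxx.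
Qed.

Lemma box_dist_same_tag' k u v :
  (k%:R < diam (tag v))%R -> (dist u v <= k%:R)%R -> tag u = tag v.
Proof.
move=> kv; case: (eqVneq (tag u) (tag v)) => // /box_dist_diff -> uvk.
have le_k : (diam (tag v) <= k%:R)%R by apply: le_trans uvk; rewrite lerDr diam_ge0.
by have := lt_le_trans kv le_k; rewrite ltxx.
Qed.

End BoxDistance.

Lemma existT_tag (I : Type) (T : I -> Type) (u : {i : I & T i}) i :
  tag u = i -> exists x, u = existT T i x.
Proof. by case: u => j x /= <-; exists x. Qed.

Section CoarseComponents.
Variables (R : realType) (m n : nat).
Variables (T : seq (free_group 'I_m)) (M : nat -> normalSubgroup (free_group 'I_m)).
Variables (S : seq (free_group 'I_n)) (N : nat -> normalSubgroup (free_group 'I_n)).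
Hypotheses (m_gt0 : 0 < m) (n_gt0 : 0 < n).
Hypotheses (genT : generates T) (genS : generates S).
Hypotheses (filM : is_filtration M) (filN : is_filtration N).
Local Notation DX := (box_dist R T (N := M)).
Local Notation DY := (box_dist R S (N := N)).

(* Since the diameters of the components tend to infinity, far out a coarse
   equivalence maps components to components. *)
Lemma coarse_components : coarsely_equivalent DX DY ->
  exists A, 0 < A /\ forall j0, exists i0, forall i, i0 <= i -> exists j, j0 <= j /\
  exists (phi : quotient_group (M j) -> quotient_group (N i))
         (psi : quotient_group (N i) -> quotient_group (M j)),
  [/\ lipschitz (quot_gen (M j)) (quot_gen (N i)) A phi,
      lipschitz (quot_gen (N i)) (quot_gen (M j)) A psi,
      forall y, near_by (quot_gen (N i)) A y (phi (psi y))
    & forall x, near_by (quot_gen (M j)) A x (psi (phi x))].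
Proof.
move=> [phi [[rm [rp [rm_prop [rp0 _] rbound]]] [C [C0 dense]]]].
have [cT [cT0 metT]] := quot_metric R genT.
have [cS [cS0 metS]] := quot_metric R genS.
pose Cn := (Num.truncn C).+1.
have /choice[back backP] : forall y, exists x, (DY y (phi x) <= Cn%:R)%R.
  move=> y; have [x xy] := dense y; exists x; apply: le_trans xy _.
  by apply: ltW; exact: truncnS_gt.
have U1 : exists A1 : nat, forall j (x : quotient_group (M j)) a,
    (DY (phi (existT _ j x)) (phi (existT _ j (x * quot_gen _ a)%g)) <= A1%:R)%R.
  (* [rp] may fail to be monotone, but distances are natural numbers, so only its values at [0],
     ..., [cT] matter. *)
  exists (\sum_(k < cT.+1) (Num.truncn (rp k%:R)%R).+1)%N => j x a.
  have [_ near_dist /(_ x (x * quot_gen _ a))[k kE]] := metT (M j).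
  have := near_dist x (x * quot_gen _ a) 1%N; rewrite kE muln1 ler_nat => kT.
  have {}kT : k < cT.+1.
    by rewrite ltnS; apply: kT; exists [:: (a, false)]; rewrite /= mulg1.
  have /andP[_] := rbound (existT _ j x) (existT _ j (x * quot_gen _ a)).
  rewrite box_dist_same kE => /le_trans; apply.
  apply: (@le_trans _ _ (Num.truncn (rp k%:R)%R).+1%:R%R); first exact/ltW/truncnS_gt.
  by rewrite ler_nat (bigD1 (Ordinal kT)) //= leq_addr.
have U2 (k : nat) : exists B : nat, forall u v, (DY (phi u) (phi v) <= k%:R)%R ->
  (DX u v <= B%:R)%R.
  have [K KP] := proper_nneg_bound k rm_prop; exists K => u v uv.
  apply: KP; first exact: box_dist_ge0.
  by have /andP[le _] := rbound u v; apply: le_trans le uv.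
have [A1 A1P] := U1.
(* Neighbours [y], [y'] give a path from [phi (back y)] through [y] and [y'] to [phi (back y')]; the
   outer [cS] converts its length to a distance. *)
pose k1 := (cS * (cS * Cn + 1 + cS * Cn))%N.
have [B1 B1P] := U2 k1; have [B2 B2P] := U2 Cn.
exists (cS * A1 + cT * B1 + cS * Cn + cT * B2).+1; split => // j0.
have [i1 i1P] := diam_unbounded R (maxn A1 Cn) n_gt0 genS filN.
have [J0 J0P] := diam_unbounded R B1 m_gt0 genT filM.
pose J := maxn J0 j0.
(* The finitely many points in components of index below [J] have images of bounded index, so far
   out [back] only reaches components of index at least [J]. *)
have [i2 i2P] : exists i2, forall u, tag u < J -> tag (phi u) < i2.
  have bound j : exists t, forall x, tag (phi (existT _ j x)) < t.
    have [_ fin _] := filM.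
    have [G [i [out [iK outK _]]]] := finite_group_model (fin j).
    exists (\max_(z : G) tag (phi (existT _ j (out z)))).+1 => x.
    by rewrite ltnS -[x]iK; apply: (leq_bigmax (i x)).
  have [t tP] := choice bound; exists (\max_(j < J) t j) => -[j x] /= jJ.
  by apply: leq_trans (tP j x) _; apply: (leq_bigmax (Ordinal jJ)).
exists (maxn i1 i2) => i; rewrite geq_max => /andP[ii1 ii2].
have diam_i k : k <= maxn A1 Cn -> (k%:R < cayley_diam R (quot_seq S (N i)))%R.
  by move=> kA; apply: le_lt_trans (i1P i ii1); rewrite ler_nat.
have tag_same u v k : k <= maxn A1 Cn -> (DY u v <= k%:R)%R -> tag u = i -> tag v = i.
  by move=> kA uv ui; rewrite -ui; apply/esym/(box_dist_same_tag genS filN _ uv);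
    rewrite ui diam_i.
have tag_same' u v k : k <= maxn A1 Cn -> (DY u v <= k%:R)%R -> tag v = i ->
  tag u = i.
  by move=> kA uv vi; rewrite -vi; apply: (box_dist_same_tag' genS filN _ uv);
    rewrite vi diam_i.
have stay j (x : quotient_group (M j)) w : tag (phi (existT _ j x)) = i ->
    tag (phi (existT _ j (x * word_eval (quot_gen (M j)) w))) = i.
  elim: w x => [|[a b] w IH] x xi; first by rewrite /= mulg1.
  rewrite /= mulgA; apply: IH; rewrite /letter_eval /=; case: b.
    apply: tag_same' (leq_maxl _ _) _ xi; rewrite -{2}(mulgVK (quot_gen _ a) x).
    exact: A1P.
  by apply: tag_same (leq_maxl _ _) _ xi; exact: A1P.
have back_tag y : tag (phi (back (existT _ i y))) = i.
  by apply: (tag_same (existT _ i y) _ Cn) => //; exact: leq_maxr.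
have back_large y : J <= tag (back (existT _ i y)).
  rewrite leqNgt; apply/negP => /i2P; rewrite back_tag => lt.
  by move: (leq_trans lt ii2); rewrite ltnn.
have phi_back_near (y : quotient_group (N i)) : exists2 z,
  phi (back (existT _ i y)) = existT _ i z &
    near_by (quot_gen (N i)) (cS * Cn) y z.
  have [z zE] := existT_tag (back_tag y); exists z => //.
  have [dist_near _ _] := metS (N i); apply: dist_near.
  by have := backP (existT _ i y); rewrite zE box_dist_same.
have back_lip (y : quotient_group (N i)) a : (DX (back (existT _ i y)) (back (existT
  _ i (y * quot_gen _ a)%g)) <= B1%:R)%R.
  apply: B1P; have [z -> yz] := phi_back_near y.
  have [z' -> yz'] := phi_back_near (y * quot_gen _ a).
  rewrite box_dist_same; have [_ near_dist _] := metS (N i); apply: near_dist.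
  apply: near_by_trans yz'; apply: near_by_trans (near_by_sym yz) _.
  by exists [:: (a, false)]; rewrite /= mulg1.
have back_step (y : quotient_group (N i)) a : tag (back (existT _ i y)) = tag (back
  (existT _ i (y * quot_gen _ a))).
  apply: (box_dist_same_tag genT filM _ (back_lip y a)); apply: J0P.
  by apply: leq_trans (back_large y); rewrite leq_maxl.
pose one : quotient_group (N i) := 1.
pose j := tag (back (existT _ i one)).
have back_words (x : quotient_group (N i)) w : tag (back (existT _ i x)) = j ->
    tag (back (existT _ i (x * word_eval (quot_gen (N i)) w))) = j.
  elim: w x => [|[a b] w IH] x xj; first by rewrite /= mulg1.
  rewrite /= mulgA; apply: IH; rewrite /letter_eval /= -xj; case: b;
    last exact/esym/back_step.
  by rewrite (back_step _ a) mulgVK.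
have back_j y : tag (back (existT _ i y)) = j.
  by have [w <-] := quot_gen_generated y; rewrite -[word_eval _ w]mul1g back_words.
have /choice[psi psiE] : forall y, exists x, back (existT _ i y) = existT _ j x.
  by move=> y; exact: (existT_tag (back_j y)).
have /choice[phi' phiE] : forall x, exists y, phi (existT _ j x) = existT _ i y.
  move=> x; suff xi : tag (phi (existT _ j x)) = i by exact: (existT_tag xi).
  have [w wE] := quot_gen_generated ((psi one)^-1 * x).
  have := @stay j (psi one) w; rewrite wE mulKVg; apply.
  by rewrite -psiE.
exists j; split; first by apply: leq_trans (back_large one); rewrite leq_maxr.
have [distM _ _] := metT (M j); have [distN _ _] := metS (N i).
exists phi', psi; split.
- move=> x a; apply: (near_byS (k := cS * A1)); first lia.
  by apply: distN; rewrite -box_dist_same -!phiE; exact: A1P.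
- move=> y a; apply: (near_byS (k := cT * B1)); first lia.
  by apply: distM; rewrite -box_dist_same -!psiE; exact: back_lip.
- move=> y; apply: (near_byS (k := cS * Cn)); first lia.
  by apply: distN; rewrite -box_dist_same -phiE -psiE; exact: backP.
- move=> x; apply: (near_byS (k := cT * B2)); first lia.
  apply: distM; rewrite -box_dist_same; apply: B2P.
  by rewrite -psiE -phiE; exact: backP.
Qed.

End CoarseComponents.

(** * Kernels of markings and finite models of quotients *)

Section Kernel.
Variables (A : choiceType) (G : groupType) (g : A -> G).

Definition word_kernel : {pred free_group A} := [pred x : free_group A | word_eval g
  x == 1].

Lemma word_kernelP (x : free_group A) : reflect (word_eval g x = 1) (x \in
  word_kernel).
Proof. exact: eqP. Qed.

Lemma word_evalM (x y : free_group A) :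
  word_eval g (x * y) = word_eval g x * word_eval g y.
Proof. exact: fg_liftM. Qed.

Lemma word_evalV (x : free_group A) : word_eval g x^-1 = (word_eval g x)^-1.
Proof. exact: word_eval_inv. Qed.

Fact word_kernel_closed : group_closed word_kernel.
Proof.
split=> [|x y /word_kernelP x1 /word_kernelP y1]; first exact/word_kernelP.
by apply/word_kernelP; rewrite word_evalM word_evalV x1 y1 invg1 mulg1.
Qed.

Fact word_kernel_conj x y : x \in word_kernel -> x ^ y \in word_kernel.
Proof.
move=> /word_kernelP x1; apply/word_kernelP.
by rewrite conjgE !word_evalM word_evalV x1 mul1g mulVg.
Qed.

Definition kernel := NormalSubgroup word_kernel_closed word_kernel_conj.

Lemma kernel_quot_gen w : word_eval (quot_gen kernel) w = 1 <-> word_eval g w = 1.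
Proof.
rewrite word_eval_quot_gen; split=> [/quot_map_eq1/word_kernelP|w1].
  by rewrite /= word_eval_reduce.
by apply/quot_map_eq1/word_kernelP; rewrite /= word_eval_reduce.
Qed.

End Kernel.

Section SameKernel.
Variables (n : nat) (G G' : groupType) (g : 'I_n -> G) (g' : 'I_n -> G').
Hypothesis ker : same_kernel g g'.

Lemma same_kernel_eq u v : word_eval g u = word_eval g v <-> word_eval g' u =
  word_eval g' v.
Proof.
have eq1 (K : groupType) (k : 'I_n -> K) : word_eval k u = word_eval k v <->
    word_eval k (u ++ word_inv v) = 1.
  rewrite word_eval_cat word_eval_inv; split=> [->|]; first by rewrite mulgV.
  by move/(canRL (mulgVK _)); rewrite mul1g.
by rewrite !eq1.
Qed.

Lemma generated_image : generated g -> generated g' ->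
  exists2 s : G -> G', injective s & forall y, exists x, s x = y.
Proof.
move=> /choice[wd wdE] gen'; exists (fun x => word_eval g' (wd x)).
  by move=> x y /same_kernel_eq; rewrite !wdE.
move=> y; have [w <-] := gen' y; exists (word_eval g w).
by apply/same_kernel_eq; rewrite wdE.
Qed.

End SameKernel.

Lemma kernel_quotient_finite (n : nat) (G : finGroupType) (g : 'I_n -> G) :
  generated g -> finite_set [set: quotient_group (kernel g)].
Proof.
move=> gen; have ker : same_kernel g (quot_gen (kernel g)).
  by move=> w; rewrite kernel_quot_gen.
have [s _ surj] := generated_image ker gen (@quot_gen_generated _ _).
suff -> : [set: quotient_group (kernel g)]%classic = (s @` setT)%classic.
  exact/finite_image/finite_finset.
by apply/esym/seteqP; split=> // y _; have [x xy] := surj y; exists x.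
Qed.

Section Model.
Variables (n : nat) (N : normalSubgroup (free_group 'I_n)).
Variables (G : finGroupType) (i : quotient_group N -> G).
Hypotheses (i_inj : injective i) (iM : {morph i : x y / x * y}).

Definition model_gen (a : 'I_n) : G := i (quot_gen N a).

Lemma model1 : i 1 = 1.
Proof. by apply: (mulgI (i 1)); rewrite -iM !mulg1. Qed.

Lemma word_eval_model w : word_eval model_gen w = i (word_eval (quot_gen N) w).
Proof.
have iV x : i x^-1 = (i x)^-1 by apply: (mulgI (i x)); rewrite -iM !mulgV model1.
elim: w => [|[a b] w IH]; first by rewrite /= model1.
by rewrite /= IH iM; congr (_ * _); case: b; rewrite /letter_eval //= iV.
Qed.

Lemma model_kernel : same_kernel model_gen (quot_gen N).
Proof.
by move=> w; rewrite word_eval_model -{1}model1; split=> [/i_inj|->].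
Qed.

Lemma model_near k x y : near_by (quot_gen N) k x y ->
  near_by model_gen k (i x) (i y).
Proof. by move=> [w [sw ->]]; exists w; rewrite iM word_eval_model. Qed.

Lemma model_generated : (forall u, exists x, i x = u) -> generated model_gen.
Proof.
move=> surj u; have [x <-] := surj u; have [w <-] := quot_gen_generated x.
by exists w; rewrite word_eval_model.
Qed.

End Model.

(** * The tower and the resulting box space *)

Record marked_group (n : nat) := MarkedGroup {
  marked_sort : finGroupType;
  marked_gen : 'I_n -> marked_sort }.

Definition tower_stage (n p l : nat) (X : marked_group n) :=
  [/\ generated (@marked_gen n X),
    p.-nat #|marked_sort X| & girth_gt (@marked_gen n X) l].

(** The stage [l] is also the ratio of the plateaus, which thus outgrows every quasi-isometry
    constant. *)
Definition tower_next (n p l : nat) (X Y : marked_group n) :=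
  (forall w, word_eval (@marked_gen n Y) w = 1 ->
    word_eval (@marked_gen n X) w = 1) /\
  exists s, forall (G : finGroupType) (f : 'I_n -> G), generated f ->
    same_kernel f (@marked_gen n Y) ->
    betti_staircase f l (if p == 2 then (n * n)%N else n) s.

Lemma marked_tower (n p : nat) : 0 < n -> prime p ->
  exists X : nat -> marked_group n, forall i,
    tower_stage p i (X i) /\ tower_next p i (X i) (X i.+1).
Proof.
move=> n0 pp.
have /choice[next nextP] : forall lX : nat * marked_group n, exists Y,
    tower_stage p lX.1 lX.2 -> tower_stage p lX.1.+1 Y /\ tower_next p lX.1 lX.2 Y.
  move=> [l X]; case: (pselect (tower_stage p l X)) => [[_ pX gX]|]; last by exists X.
  have [G [g [gen pG gir ker stair]]] := tower_step l n0 pp pX gX.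
  by exists (MarkedGroup g).
pose X := fix X i : marked_group n := if i is l.+1 then next (l, X l)
  else MarkedGroup (fun _ : 'I_n => 1 : {perm 'I_0}).
have stage i : tower_stage p i (X i).
  elim: i => [|i IH]; last by case: (nextP (i, X i) IH).
  split=> [x||]; last by move=> [].
    by exists [::]; apply/permP => -[].
  by rewrite card_Sn.
by exists X => i; split; [exact: stage|case: (nextP (i, X i) (stage i))].
Qed.

Theorem theorem1p12 (R : realType) (n : nat) (hn : 3 <= n)
    (S : seq (free_group 'I_n)) (hS : generates S) :
  exists N : nat -> normalSubgroup (free_group 'I_n),
    is_filtration N /\
    forall m : nat, 0 < m -> coprime m.-1 n.-1 ->
    forall (T : seq (free_group 'I_m)) (M : nat -> normalSubgroup (free_group 'I_m)),
      generates T -> is_filtration M ->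
      ~ coarsely_equivalent (box_dist R T (N := M)) (box_dist R S (N := N)).
Proof.
have n0 : 0 < n by exact: leq_trans hn.
have pp : prime (pdiv n.-1) by apply: pdiv_prime; lia.
have [X XP] := marked_tower n0 pp; set p := pdiv n.-1 in pp XP.
pose N i := kernel (@marked_gen n (X i)).
have fil : is_filtration N.
  split=> [i x /word_kernelP x1|i|x xN].
  - by apply/word_kernelP; have [_ [ker _]] := XP i; apply: ker.
  - by have [[gen _ _] _] := XP i; apply: kernel_quotient_finite.
  - have [[_ _ gir] _] := XP (size (fg_word x)); apply: val_inj.
    by apply: gir => //; [exact: fg_reduced|exact/word_kernelP/xN].
exists N; split=> // m m0 co T M genT filM.
move=> /(coarse_components m0 n0 genT hS filM fil)[A [A0 comps]].
have [j0 j0P] := filtration_girth (A * (A + 3)) filM.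
have [i0 i0P] := comps j0.
(* The summands make the component far enough out, its girth exceed [A * (A + 3)], and its plateau
   ratio at least [A * A] and [A + 3]. *)
pose l := i0 + A * (A + 3) + (A + 3).
have [j [jj0 [phi [psi [lphi lpsi phiK psiK]]]]] := i0P l.+1 ltac:(rewrite /l; lia).
have [[_ _ girX] _] := XP l.+1.
have [[genX _ _] [_ [s stair]]] := XP l.
have [[genX1 pX1 _] _] := XP l.+1.
have [_ finN _] := fil; have [_ finM _] := filM.
have [G [iN [oN [iNK oNK iNM]]]] := finite_group_model (finN l.+1).
have [H [iM [oM [iMK oMK iMM]]]] := finite_group_model (finM j).
have iN_inj := can_inj iNK; have iM_inj := can_inj iMK.
have gen_g : generated (model_gen iN).
  by apply: model_generated => // u; exists (oN u); rewrite oNK.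
have gen_h : generated (model_gen iM).
  by apply: model_generated => // u; exists (oM u); rewrite oMK.
have ker_g : same_kernel (model_gen iN) (@marked_gen n (X l.+1)).
  by move=> w; rewrite (model_kernel iN_inj iNM) kernel_quot_gen.
have pG : p.-nat #|G|.
  suff -> : #|G| = #|marked_sort (X l.+1)| by [].
  have ker_g' : same_kernel (@marked_gen n (X l.+1)) (model_gen iN).
    by move=> w; rewrite (ker_g w).
  have [t /leq_card le1 _] := generated_image ker_g gen_g genX1.
  have [t' /leq_card le2 _] := generated_image ker_g' genX1 gen_g.
  by apply/eqP; rewrite eqn_leq le1 le2.
have large : [/\ A * (A + 3) <= l.+1, (A * A <= l)%N & A + 3 <= l].
  by rewrite /l mulnDr; split; lia.
have [l1 l2 l3] := large.
apply: (@no_quasi_isometry n m A l G H (model_gen iN) (model_gen iM)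
  (fun x => iN (phi (oM x))) (fun y => iM (psi (oN y))) s) => //.
- move=> x a; have := model_near iNM (lphi (oM x) a); congr near_by.
  by congr (iN (phi _)); apply: iM_inj; rewrite iMM !oMK.
- move=> y a; have := model_near iMM (lpsi (oN y) a); congr near_by.
  by congr (iM (psi _)); apply: iN_inj; rewrite iNM !oNK.
- by move=> y; have := model_near iNM (phiK (oN y)); rewrite oNK iMK.
- by move=> x; have := model_near iMM (psiK (oM x)); rewrite oMK iNK.
- by move=> w rw sw /ker_g; apply: girX => //; apply: leq_trans l1.
- by move=> w rw sw /(model_kernel iM_inj iMM); apply: (j0P j).
- exact: stair.
Qed.
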